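(* There exists a real number that is regainingly approximable and nearly computable but not computable.
   Context: A real $x$ is computable if there is a computable sequence of rationals $(x_n)_n$ with $|x-x_n|<2^{-n}$ for all $n$. A real $x$ is regainingly approximable if there is a computable non-decreasing sequence of rationals $(x_n)_n$ converging to $x$ with $x - x_n < 2^{-n}$ for infinitely many $n\in\mathbb{N}$. A function $f:\mathbb{N}\to\mathbb{N}$ is a modulus of convergence of a convergent sequence $(y_n)_n$ with limit $y$ if for all $n$ and all $m\ge f(n)$ we have $|y-y_m|<2^{-n}$; $(y_n)_n$ converges computably if it has a computable modulus of convergence. A sequence $(x_n)_n$ converges nearly computably if it converges and for every computable increasing function $s:\mathbb{N}\to\mathbb{N}$ the sequence $(x_{s(n+1)}-x_{s(n)})_n$ converges computably to $0$. A real is nearly computable if some computable sequence of rationals converges nearly computably to it. *)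

(* Defs.v *)
From Stdlib Require Import Reals QArith Qreals List.
Import ListNotations.
Open Scope R_scope.

(** * A model of computation: (partial) mu-recursive functions on lists of nats. *)
Inductive code : Type :=
| CZero : code
| CSucc : code
| CProj : nat -> code
| CComp : code -> list code -> code
| CPrec : code -> code -> code
| CMu   : code -> code.

Inductive eval : code -> list nat -> nat -> Prop :=
| ev_zero : forall v, eval CZero v 0
| ev_succ : forall x v, eval CSucc (x :: v) (S x)
| ev_proj : forall i v, (i < length v)%nat -> eval (CProj i) v (nth i v 0%nat)
| ev_comp : forall f gs v ys y,
    evalL gs v ys -> eval f ys y -> eval (CComp f gs) v y
| ev_prec0 : forall f g v y, eval f v y -> eval (CPrec f g) (0%nat :: v) y
| ev_precS : forall f g n v z y,
    eval (CPrec f g) (n :: v) z -> eval g (n :: z :: v) y ->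
    eval (CPrec f g) (S n :: v) y
| ev_mu : forall f v n,
    eval f (n :: v) 0%nat ->
    (forall m, (m < n)%nat -> exists k, eval f (m :: v) (S k)) ->
    eval (CMu f) v n
with evalL : list code -> list nat -> list nat -> Prop :=
| evL_nil : forall v, evalL [] v []
| evL_cons : forall g gs v y ys,
    eval g v y -> evalL gs v ys -> evalL (g :: gs) v (y :: ys).

Definition computable_fun (f : nat -> nat) : Prop :=
  exists c : code, forall n, eval c [n] (f n).

Definition computable_Qseq (q : nat -> Q) : Prop :=
  exists a b d : nat -> nat,
    computable_fun a /\ computable_fun b /\ computable_fun d /\
    forall n, q n = Qmake (Z.of_nat (a n) - Z.of_nat (b n)) (Pos.of_succ_nat (d n)).

Definition computable_real (x : R) : Prop :=
  exists q : nat -> Q, computable_Qseq q /\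
    forall n, Rabs (x - Q2R (q n)) < / 2 ^ n.

Definition regainingly_approximable (x : R) : Prop :=
  exists q : nat -> Q, computable_Qseq q /\
    (forall n, Q2R (q n) <= Q2R (q (S n))) /\
    Un_cv (fun n => Q2R (q n)) x /\
    (forall N, exists n, (N <= n)%nat /\ x - Q2R (q n) < / 2 ^ n).

Definition is_modulus (f : nat -> nat) (y : nat -> R) (l : R) : Prop :=
  forall n m, (f n <= m)%nat -> Rabs (l - y m) < / 2 ^ n.

Definition converges_computably_to (y : nat -> R) (l : R) : Prop :=
  exists f, computable_fun f /\ is_modulus f y l.

Definition strictly_increasing (s : nat -> nat) : Prop :=
  forall n, (s n < s (S n))%nat.

Definition converges_nearly_computably_to (y : nat -> R) (l : R) : Prop :=
  Un_cv y l /\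
  forall s, computable_fun s -> strictly_increasing s ->
    converges_computably_to (fun n => y (s (S n)) - y (s n)) 0.

Definition nearly_computable (x : R) : Prop :=
  exists q : nat -> Q, computable_Qseq q /\
    converges_nearly_computably_to (fun n => Q2R (q n)) x.

(* Main.v *)
(** An infinite injury construction on a tree of strategies. A non-decreasing computable
sequence [approx] is built in stages. A node of level [e] makes [approx] jump by [2^-k]
once the [e]-th program has converged at [k], so that this program is not a modulus of
convergence of [approx]. It also watches the [e]-th program as a candidate for a strictly
increasing [s]: a stage is expansionary if a new value of [s] has appeared since the last
expansionary stage. Whatever the strategies below the infinitary outcome want to add is
put into a gate, which cuts it at stage [t] into chunks of size [2^-t] and lets one chunk
pass at each expansionary stage; nothing below the gate acts before the gate is empty.
Hence an interval between [s m] and [s (m+1)] sees at most two chunks, and their size is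
bounded by the last stage at which the gate was empty, which can be computed from [m].
Strategies guessing that there are no more expansionary stages restart at each of them
with jumps below [2^-t].

A node created at stage [t] never emits more than [2^-t] together with everything of
lower priority. At the stage [t] of the last creation of a node on the true path this is
all that is still to come, so the limit is regained there. *)

Require Import Defs.
From Stdlib Require Import Reals QArith Qreals List Lia Lra Cantor Wf_nat Classical ConstructiveEpsilon.
Import ListNotations.
Open Scope nat_scope.

(** * Pairing and computable functions of several arguments *)

Definition pr (x y : nat) : nat := Cantor.to_nat (x, y).
Definition p1 (z : nat) : nat := fst (Cantor.of_nat z).
Definition p2 (z : nat) : nat := snd (Cantor.of_nat z).
Arguments pr : simpl never.
Arguments p1 : simpl never.
Arguments p2 : simpl never.

Lemma p1_pr x y : p1 (pr x y) = x.
Proof. unfold p1, pr. now rewrite Cantor.cancel_of_to. Qed.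

Lemma p2_pr x y : p2 (pr x y) = y.
Proof. unfold p2, pr. now rewrite Cantor.cancel_of_to. Qed.

Lemma pr_ge x y : x + y <= pr x y.
Proof. unfold pr. pose proof (Cantor.to_nat_non_decreasing x y). lia. Qed.

(** [computable_fun] is about unary functions, while recursion and minimisation change the arity;
    hence this version for argument lists of a fixed length. *)
Definition computable_vec (k : nat) (F : list nat -> nat) : Prop :=
  exists c, forall v, length v = k -> eval c v (F v).

Lemma vec_ext k F G : (forall v, length v = k -> F v = G v) ->
  computable_vec k F -> computable_vec k G.
Proof. intros H [c Hc]. exists c. intros v Hv. rewrite <- H by easy. auto. Qed.

Lemma vec_proj k i : i < k -> computable_vec k (fun v => nth i v 0).
Proof. intros Hi. exists (CProj i). intros v Hv. constructor. lia. Qed.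

Lemma vec_zero k : computable_vec k (fun _ => 0).
Proof. exists CZero. intros. constructor. Qed.

Lemma vec_comp1 k G F : computable_vec 1 G -> computable_vec k F ->
  computable_vec k (fun v => G [F v]).
Proof.
  intros [c Hc] [d Hd]. exists (CComp c [d]). intros v Hv.
  econstructor; [|apply Hc; reflexivity]. repeat constructor. auto.
Qed.

Lemma vec_comp2 k G F1 F2 : computable_vec 2 G -> computable_vec k F1 ->
  computable_vec k F2 -> computable_vec k (fun v => G [F1 v; F2 v]).
Proof.
  intros [c Hc] [d1 Hd1] [d2 Hd2]. exists (CComp c [d1; d2]). intros v Hv.
  econstructor; [|apply Hc; reflexivity]. repeat constructor; auto.
Qed.

Lemma vec_succ k F : computable_vec k F -> computable_vec k (fun v => S (F v)).
Proof.
  intros [d Hd]. exists (CComp CSucc [d]). intros v Hv.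
  econstructor; [repeat constructor; eauto|constructor].
Qed.

Lemma vec_prec k f g : computable_vec k f -> computable_vec (S (S k)) g ->
  computable_vec (S k) (fun v =>
    nat_rect (fun _ => nat) (f (tl v)) (fun i z => g (i :: z :: tl v)) (hd 0 v)).
Proof.
  intros [c Hc] [d Hd]. exists (CPrec c d). intros [|n v] Hv; [easy|].
  injection Hv as Hv. cbn [tl hd]. induction n as [|n IH]; cbn [nat_rect].
  - constructor. auto.
  - econstructor; [exact IH|]. apply Hd. cbn. lia.
Qed.

Lemma vec_mu k g (h : list nat -> nat) : computable_vec (S k) g ->
  (forall v, length v = k -> g (h v :: v) = 0 /\ forall m, m < h v -> g (m :: v) <> 0) ->
  computable_vec k h.
Proof.
  intros [c Hc] Hh. exists (CMu c). intros v Hv. destruct (Hh v Hv) as [H0 Hm].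
  constructor.
  - rewrite <- H0. apply Hc. cbn. lia.
  - intros m Hlt. exists (pred (g (m :: v))).
    specialize (Hm m Hlt). rewrite Nat.succ_pred by easy. apply Hc. cbn. lia.
Qed.

Lemma computable_fun_vec f : computable_fun f <-> computable_vec 1 (fun v => f (hd 0 v)).
Proof.
  split; intros [c Hc]; exists c.
  - now intros [|x [|y v]] Hv.
  - intros n. now apply (Hc [n]).
Qed.

Lemma vec_add : computable_vec 2 (fun v => hd 0 v + nth 1 v 0).
Proof.
  eapply vec_ext; [|apply vec_prec with (f := fun v => nth 0 v 0)
    (g := fun v => S (nth 1 v 0)); [apply vec_proj; lia|apply vec_succ, vec_proj; lia]].
  intros [|x [|y [|]]] Hv; try easy. cbn. induction x; cbn; auto.
Qed.

Lemma vec_pred : computable_vec 1 (fun v => pred (hd 0 v)).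
Proof.
  eapply vec_ext; [|apply vec_prec with (f := fun v => 0) (g := fun v => nth 0 v 0);
    [apply vec_zero|apply vec_proj; lia]].
  intros [|x [|]] Hv; try easy. cbn. now destruct x.
Qed.

(** Primitive recursion runs on the first argument, so the number to be subtracted comes first. *)
Lemma vec_rsub : computable_vec 2 (fun v => nth 1 v 0 - hd 0 v).
Proof.
  eapply vec_ext; [|apply vec_prec with (f := fun v => nth 0 v 0)
    (g := fun v => pred (hd 0 [nth 1 v 0]));
    [apply vec_proj; lia
    |exact (vec_comp1 3 _ _ vec_pred (vec_proj 3 1 ltac:(lia)))]].
  intros [|x [|y [|]]] Hv; try easy. cbn [nth hd tl].
  clear Hv. induction x as [|x IH]; cbn [nat_rect]; [lia|]. rewrite IH. cbn [hd nth]. lia.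
Qed.

(** The triangular numbers, in the form in which they occur in Cantor pairing, so that [pr_triangle]
    holds by computation. *)
Definition triangle (w : nat) : nat := nat_rec _ 0 (fun i m => S i + m) w.

Lemma vec_triangle : computable_vec 1 (fun v => triangle (hd 0 v)).
Proof.
  eapply vec_ext; [|apply vec_prec with (f := fun v => 0)
    (g := fun v => S (hd 0 [nth 0 v 0; nth 1 v 0] + nth 1 [nth 0 v 0; nth 1 v 0] 0));
    [apply vec_zero
    |exact (vec_succ _ _ (vec_comp2 2 _ _ _ vec_add (vec_proj 2 0 ltac:(lia))
        (vec_proj 2 1 ltac:(lia))))]].
  intros [|x [|]] Hv; try easy.
Qed.

Lemma pr_triangle x y : pr x y = y + triangle (y + x).
Proof. reflexivity. Qed.

Lemma vec_pr : computable_vec 2 (fun v => pr (hd 0 v) (nth 1 v 0)).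
Proof.
  pose proof (vec_proj 2 0 ltac:(lia)) as H0. pose proof (vec_proj 2 1 ltac:(lia)) as H1.
  eapply vec_ext; [|exact (vec_comp2 2 _ _ _ vec_add H1
    (vec_comp1 2 _ _ vec_triangle (vec_comp2 2 _ _ _ vec_add H1 H0)))].
  intros [|x [|y [|]]] Hv; try easy.
Qed.

Definition diagonal (z : nat) : nat := p1 z + p2 z.

Lemma triangle_S w : triangle (S w) = S w + triangle w.
Proof. reflexivity. Qed.

Lemma triangle_mono w w' : w <= w' -> triangle w <= triangle w'.
Proof. induction 1; [lia|]. rewrite triangle_S. lia. Qed.

Lemma pr_p1_p2 z : pr (p1 z) (p2 z) = z.
Proof.
  unfold pr, p1, p2. rewrite <- surjective_pairing. apply Cantor.cancel_to_of.
Qed.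

Lemma triangle_diagonal z : p2 z + triangle (diagonal z) = z.
Proof.
  rewrite <- (pr_p1_p2 z) at 3. rewrite pr_triangle. unfold diagonal.
  now rewrite (Nat.add_comm (p2 z) (p1 z)).
Qed.

(** The diagonal of [z] is the least [m] with [z < triangle (S m)]. Both projections follow from it
    by subtraction. *)
Lemma vec_diagonal : computable_vec 1 (fun v => diagonal (hd 0 v)).
Proof.
  pose proof (vec_proj 2 0 ltac:(lia)) as H0. pose proof (vec_proj 2 1 ltac:(lia)) as H1.
  apply vec_mu with (g := fun v => S (nth 1 v 0) - triangle (S (nth 0 v 0))).
  - exact (vec_comp2 2 _ _ _ vec_rsub (vec_comp1 2 _ _ vec_triangle (vec_succ _ _ H0))
      (vec_succ _ _ H1)).
  - intros [|z [|]] Hv; try easy. cbn [nth hd].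
    pose proof (triangle_diagonal z) as Hz.
    assert (Hd : p2 z <= diagonal z) by (unfold diagonal; lia).
    split.
    + rewrite triangle_S. lia.
    + intros m Hm. pose proof (triangle_mono (S m) (diagonal z) Hm). lia.
Qed.

Lemma computable_p2 : computable_fun p2.
Proof.
  apply computable_fun_vec. pose proof (vec_proj 1 0 ltac:(lia)) as H0.
  eapply vec_ext; [|exact (vec_comp2 1 _ _ _ vec_rsub
    (vec_comp1 1 _ _ vec_triangle vec_diagonal) H0)].
  intros [|z [|]] Hv; try easy. cbn [nth hd]. pose proof (triangle_diagonal z). lia.
Qed.

Lemma computable_p1 : computable_fun p1.
Proof.
  apply computable_fun_vec.
  eapply vec_ext; [|exact (vec_comp2 1 _ _ _ vec_rsub
    (proj1 (computable_fun_vec _) computable_p2) vec_diagonal)].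
  intros [|z [|]] Hv; try easy. cbn [nth hd]. unfold diagonal. lia.
Qed.

(** * Closure properties of computable functions *)

Lemma computable_ext f g : (forall x, f x = g x) -> computable_fun f -> computable_fun g.
Proof. intros H [c Hc]. exists c. intros n. rewrite <- H. apply Hc. Qed.

Lemma computable_id : computable_fun (fun x => x).
Proof. exists (CProj 0). intros n. apply (ev_proj 0 [n]). cbn. lia. Qed.

Lemma computable_comp f g : computable_fun f -> computable_fun g ->
  computable_fun (fun x => f (g x)).
Proof.
  intros [c Hc] [d Hd]. exists (CComp c [d]). intros n.
  econstructor; [|apply Hc]. repeat constructor. auto.
Qed.

Lemma computable_succ f : computable_fun f -> computable_fun (fun x => S (f x)).
Proof.
  intros [d Hd]. exists (CComp CSucc [d]). intros v.
  econstructor; [repeat constructor; eauto|constructor].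
Qed.

Lemma computable_const n : computable_fun (fun _ => n).
Proof.
  induction n; [exists CZero; constructor|now apply computable_succ].
Qed.

Lemma computable_pr f g : computable_fun f -> computable_fun g ->
  computable_fun (fun x => pr (f x) (g x)).
Proof.
  intros Hf Hg. apply computable_fun_vec in Hf, Hg. apply computable_fun_vec.
  exact (vec_comp2 1 _ _ _ vec_pr Hf Hg).
Qed.

Definition computable2 (F : nat -> nat -> nat) : Prop :=
  computable_fun (fun p => F (p1 p) (p2 p)).

Definition computable3 (F : nat -> nat -> nat -> nat) : Prop :=
  computable_fun (fun p => F (p1 p) (p1 (p2 p)) (p2 (p2 p))).

Lemma computable_app2 F f g : computable2 F -> computable_fun f -> computable_fun g ->
  computable_fun (fun x => F (f x) (g x)).
Proof.
  intros HF Hf Hg.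
  eapply computable_ext; [|exact (computable_comp _ _ HF (computable_pr _ _ Hf Hg))].
  intros x. cbn. now rewrite p1_pr, p2_pr.
Qed.

Lemma computable_app3 F f g h : computable3 F -> computable_fun f -> computable_fun g ->
  computable_fun h -> computable_fun (fun x => F (f x) (g x) (h x)).
Proof.
  intros HF Hf Hg Hh.
  eapply computable_ext;
    [|exact (computable_comp _ _ HF (computable_pr _ _ Hf (computable_pr _ _ Hg Hh)))].
  intros x. cbn. now rewrite !p2_pr, !p1_pr.
Qed.

Lemma computable_fst f : computable_fun f -> computable_fun (fun x => p1 (f x)).
Proof. apply computable_comp, computable_p1. Qed.

Lemma computable_snd f : computable_fun f -> computable_fun (fun x => p2 (f x)).
Proof. apply computable_comp, computable_p2. Qed.

Lemma computable_rec (f n : nat -> nat) (g : nat -> nat -> nat -> nat) :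
  computable_fun f -> computable3 g -> computable_fun n ->
  computable_fun (fun x => nat_rect (fun _ => nat) (f x) (g x) (n x)).
Proof.
  intros Hf Hg Hn.
  pose proof (vec_proj 3 0 ltac:(lia)) as P0. pose proof (vec_proj 3 1 ltac:(lia)) as P1.
  pose proof (vec_proj 3 2 ltac:(lia)) as P2.
  apply computable_fun_vec in Hf, Hg, Hn. apply computable_fun_vec.
  eapply vec_ext; [|exact (vec_comp2 1 _ _ _ (vec_prec _ _ _ Hf
    (vec_comp1 3 _ _ Hg (vec_comp2 3 _ _ _ vec_pr P2 (vec_comp2 3 _ _ _ vec_pr P0 P1))))
    Hn (vec_proj 1 0 ltac:(lia)))].
  intros [|x [|]] Hv; try easy. cbn [hd tl nth].
  induction (n x) as [|m IH]; cbn [nat_rect]; [easy|].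
  rewrite IH. now rewrite !p2_pr, !p1_pr.
Qed.

(** Decidability of [g x n = 0] allows the least zero to be chosen as a function of [x], and this is
    the function that minimisation computes. *)
Lemma computable_search (g : nat -> nat -> nat) :
  computable2 g -> (forall x, exists n, g x n = 0) ->
  exists f, computable_fun f /\ forall x, g x (f x) = 0.
Proof.
  intros Hg Hex.
  set (least := fun x => epsilon_smallest (fun n => g x n = 0)
    (fun n => Nat.eq_dec (g x n) 0) (Hex x)).
  set (f := fun x => proj1_sig (least x)).
  assert (Hf : forall x, g x (f x) = 0 /\ forall m, m < f x -> g x m <> 0).
  { intros x. destruct (proj2_sig (least x)) as [H0 Hm]. split; [easy|].
    intros m Hlt H. specialize (Hm m H). fold (f x) in Hm. lia. }
  exists f. split; [|apply Hf].
  apply computable_fun_vec in Hg. apply computable_fun_vec.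
  apply vec_mu with (g := fun v => g (nth 1 v 0) (nth 0 v 0)).
  - eapply vec_ext; [|exact (vec_comp1 2 _ _ Hg (vec_comp2 2 _ _ _ vec_pr
      (vec_proj 2 1 ltac:(lia)) (vec_proj 2 0 ltac:(lia))))].
    intros v Hv. cbn. now rewrite p1_pr, p2_pr.
  - intros [|x [|]] Hv; try easy.
Qed.
Create HintDb comp.
#[export] Hint Constants Opaque : comp.
#[export] Hint Resolve computable_id computable_const computable_succ computable_pr
  computable_fst computable_snd : comp.

Ltac comp := unfold computable2, computable3; auto 60 with comp nocore.

Lemma computable_add f g : computable_fun f -> computable_fun g ->
  computable_fun (fun x => f x + g x).
Proof.
  intros Hf Hg. apply computable_app2; auto.
  apply computable_ext with
    (fun p => nat_rect (fun _ => nat) (p1 p) (fun _ z => S z) (p2 p)).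
  - intros p. induction (p2 p) as [|n IH]; cbn; lia.
  - apply computable_rec with (g := fun _ _ z => S z); comp.
Qed.
#[export] Hint Resolve computable_add : comp.

Lemma computable_pred f : computable_fun f -> computable_fun (fun x => pred (f x)).
Proof.
  intros Hf. apply computable_fun_vec in Hf. apply computable_fun_vec.
  exact (vec_comp1 1 _ _ vec_pred Hf).
Qed.
#[export] Hint Resolve computable_pred : comp.

Lemma computable_sub f g : computable_fun f -> computable_fun g ->
  computable_fun (fun x => f x - g x).
Proof.
  intros Hf Hg. apply computable_fun_vec in Hf, Hg. apply computable_fun_vec.
  exact (vec_comp2 1 _ _ _ vec_rsub Hg Hf).
Qed.
#[export] Hint Resolve computable_sub : comp.

Lemma computable_mul f g : computable_fun f -> computable_fun g ->
  computable_fun (fun x => f x * g x).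
Proof.
  intros Hf Hg. apply computable_app2; auto.
  apply computable_ext with
    (fun p => nat_rect (fun _ => nat) 0 (fun _ z => z + p2 p) (p1 p)).
  - intros p. induction (p1 p) as [|n IH]; cbn; lia.
  - apply computable_rec with (g := fun p _ z => z + p2 p); comp.
Qed.
#[export] Hint Resolve computable_mul : comp.

Lemma computable_pow f g : computable_fun f -> computable_fun g ->
  computable_fun (fun x => f x ^ g x).
Proof.
  intros Hf Hg. apply computable_app2; auto.
  apply computable_ext with
    (fun p => nat_rect (fun _ => nat) 1 (fun _ z => p1 p * z) (p2 p)).
  - intros p. induction (p2 p) as [|n IH]; cbn; [|rewrite IH]; auto.
  - apply computable_rec with (g := fun p _ z => p1 p * z); comp.
Qed.
#[export] Hint Resolve computable_pow : comp.

Lemma computable_if (b : nat -> bool) f g : computable_fun (fun x => Nat.b2n (b x)) ->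
  computable_fun f -> computable_fun g ->
  computable_fun (fun x => if b x then f x else g x).
Proof.
  intros Hb Hf Hg.
  apply computable_ext with (fun x => Nat.b2n (b x) * f x + (1 - Nat.b2n (b x)) * g x).
  - intros x. destruct (b x); cbn; lia.
  - comp.
Qed.
#[export] Hint Resolve computable_if : comp.

Lemma computable_leb f g : computable_fun f -> computable_fun g ->
  computable_fun (fun x => Nat.b2n (f x <=? g x)).
Proof.
  intros Hf Hg. apply computable_ext with (fun x => 1 - (f x - g x)); [|comp].
  intros x. destruct (Nat.leb_spec (f x) (g x)); cbn [Nat.b2n]; lia.
Qed.
#[export] Hint Resolve computable_leb : comp.

Lemma computable_ltb f g : computable_fun f -> computable_fun g ->
  computable_fun (fun x => Nat.b2n (f x <? g x)).
Proof. intros Hf Hg. apply (computable_leb (fun x => S (f x)) g); comp. Qed.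
#[export] Hint Resolve computable_ltb : comp.

Lemma computable_andb (b c : nat -> bool) : computable_fun (fun x => Nat.b2n (b x)) ->
  computable_fun (fun x => Nat.b2n (c x)) ->
  computable_fun (fun x => Nat.b2n (b x && c x)).
Proof.
  intros Hb Hc. apply computable_ext with (fun x => Nat.b2n (b x) * Nat.b2n (c x)); [|comp].
  intros x. now destruct (b x), (c x).
Qed.
#[export] Hint Resolve computable_andb : comp.

Lemma computable_negb (b : nat -> bool) : computable_fun (fun x => Nat.b2n (b x)) ->
  computable_fun (fun x => Nat.b2n (negb (b x))).
Proof.
  intros Hb. apply computable_ext with (fun x => 1 - Nat.b2n (b x)); [|comp].
  intros x. now destruct (b x).
Qed.
#[export] Hint Resolve computable_negb : comp.

Lemma computable_eqb f g : computable_fun f -> computable_fun g ->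
  computable_fun (fun x => Nat.b2n (f x =? g x)).
Proof.
  intros Hf Hg. apply computable_ext with
    (fun x => Nat.b2n ((f x <=? g x) && (g x <=? f x))); [|comp].
  intros x. destruct (Nat.leb_spec (f x) (g x)), (Nat.leb_spec (g x) (f x)),
    (Nat.eqb_spec (f x) (g x)); cbn; lia.
Qed.
#[export] Hint Resolve computable_eqb : comp.

Lemma computable_existsb (b : nat -> nat -> bool) n :
  computable2 (fun x i => Nat.b2n (b x i)) -> computable_fun n ->
  computable_fun (fun x => Nat.b2n (existsb (b x) (seq 0 (n x)))).
Proof.
  intros Hb Hn.
  apply computable_ext with (fun x => nat_rect (fun _ => nat) 0
    (fun i z => if b x i then 1 else z) (n x)).
  - intros x. induction (n x) as [|m IH]; [easy|].
    rewrite seq_S, existsb_app. cbn. rewrite IH.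
    now destruct (b x m), (existsb (b x) (seq 0 m)).
  - apply computable_rec with (g := fun x i z => if b x i then 1 else z); [comp| |comp].
    unfold computable3. apply computable_if; [|comp|comp].
    apply (computable_app2 _ _ _ Hb); comp.
Qed.

Lemma computable_iter (F : nat -> nat) n f : computable_fun F -> computable_fun n ->
  computable_fun f -> computable_fun (fun x => Nat.iter (n x) F (f x)).
Proof.
  intros HF Hn Hf.
  apply computable_rec with (g := fun _ _ z => F z); auto.
  apply computable_comp; comp.
Qed.

(** * Codes of lists *)

Definition cons_code (a l : nat) : nat := S (pr a l).
Definition hd_code (l : nat) : nat := p1 (pred l).
Definition tl_code (l : nat) : nat := p2 (pred l).
Definition nth_code (i l : nat) : nat := hd_code (Nat.iter i tl_code l).
Definition list_code (l : list nat) : nat := fold_right cons_code 0 l.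

Lemma computable_cons f g : computable_fun f -> computable_fun g ->
  computable_fun (fun x => cons_code (f x) (g x)).
Proof. unfold cons_code. comp. Qed.

Lemma computable_hd f : computable_fun f -> computable_fun (fun x => hd_code (f x)).
Proof. unfold hd_code. comp. Qed.

Lemma computable_tl f : computable_fun f -> computable_fun (fun x => tl_code (f x)).
Proof. unfold tl_code. comp. Qed.
#[export] Hint Resolve computable_cons computable_hd computable_tl : comp.

Lemma computable_nth f g : computable_fun f -> computable_fun g ->
  computable_fun (fun x => nth_code (f x) (g x)).
Proof.
  intros. apply computable_hd, computable_iter; comp.
Qed.
#[export] Hint Resolve computable_nth : comp.

Lemma hd_cons a l : hd_code (cons_code a l) = a.
Proof. apply p1_pr. Qed.

Lemma tl_cons a l : tl_code (cons_code a l) = l.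
Proof. apply p2_pr. Qed.

Lemma nth_code_S i a l : nth_code (S i) (cons_code a l) = nth_code i l.
Proof. unfold nth_code. now rewrite Nat.iter_succ_r, tl_cons. Qed.

Lemma nth_code_spec i l : i < length l -> nth_code i (list_code l) = nth i l 0.
Proof.
  revert i. induction l as [|a l IH]; cbn [length list_code fold_right]; intros i Hi; [lia|].
  destruct i as [|i]; [apply hd_cons|]. rewrite nth_code_S. apply IH. lia.
Qed.

(** * Course-of-values recursion *)

Definition cov_history (G : nat -> nat -> nat -> nat) (p n : nat) : nat :=
  nat_rect (fun _ => nat) 0 (fun i h => cons_code (G p i h) h) n.

Definition cov_rec (G : nat -> nat -> nat -> nat) (p n : nat) : nat :=
  G p n (cov_history G p n).

(** The history has the latest value first, so the value at [i] stands at position [n - S i]. *)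
Definition cov_lookup (n i h : nat) : nat := nth_code (n - S i) h.

Lemma cov_lookup_spec G p n i : i < n ->
  cov_lookup n i (cov_history G p n) = cov_rec G p i.
Proof.
  unfold cov_lookup. induction 1 as [|n Hle IH].
  - rewrite Nat.sub_diag. apply hd_cons.
  - replace (S n - S i) with (S (n - S i)) by lia.
    cbn [cov_history nat_rect]. now rewrite nth_code_S.
Qed.

Lemma computable_cov_rec G f g : computable3 G -> computable_fun f -> computable_fun g ->
  computable_fun (fun x => cov_rec G (f x) (g x)).
Proof.
  intros HG Hf Hg. apply computable_app3; auto.
  apply computable_rec with (g := fun x i h => cons_code (G (f x) i h) h); [comp| |auto].
  unfold computable3. apply computable_cons; [|comp].
  apply (computable_app3 G); auto with comp nocore.
  apply (computable_comp f); comp.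
Qed.

(** * A universal abstract machine *)

Fixpoint code_nat (c : code) : nat :=
  match c with
  | CZero => pr 0 0
  | CSucc => pr 1 0
  | CProj i => pr 2 i
  | CComp f gs => pr 3 (pr (code_nat f) (list_code (map code_nat gs)))
  | CPrec f g => pr 4 (pr (code_nat f) (code_nat g))
  | CMu f => pr 5 (code_nat f)
  end.

(* A configuration [config m a b K] has a control part and a stack [K] of frames:
   [m = 0] evaluates the program [a] on the argument list [b], [m = 1] evaluates
   the list of programs [a] on [b], and [m = 2] returns the value [a]. *)
Definition config (m a b K : nat) : nat := pr m (pr a (pr b K)).
Definition cfg_run := config 0.
Definition cfg_runs := config 1.
Definition cfg_ret (a K : nat) : nat := config 2 a 0 K.

Definition step_run (a b K : nat) : nat :=
  let d := p2 a in
  if p1 a =? 0 then cfg_ret 0 K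
  else if p1 a =? 1 then cfg_ret (S (hd_code b)) K
  else if p1 a =? 2 then cfg_ret (nth_code d b) K
  else if p1 a =? 3 then cfg_runs (p2 d) b (cons_code (pr 0 (p1 d)) K)
  else if p1 a =? 4 then
    if hd_code b =? 0 then cfg_run (p1 d) (tl_code b) K
    else cfg_run a (cons_code (pred (hd_code b)) (tl_code b))
           (cons_code (pr 1 (pr (p2 d) (pr (pred (hd_code b)) (tl_code b)))) K)
  else cfg_run d (cons_code 0 b) (cons_code (pr 2 (pr d (pr 0 b))) K).

Definition step_runs (a b K : nat) : nat :=
  if a =? 0 then cfg_ret 0 K
  else cfg_run (hd_code a) b (cons_code (pr 3 (pr (tl_code a) b)) K).

(** The tag of the top frame tells what waits for the value: 0 a composition, 1 a recursion step, 2
    a minimisation loop, 3 the rest of a list of programs, 4 the head of a list of values. With the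
    empty stack 0 the configuration is a fixed point. *)
Definition step_ret (a K : nat) : nat :=
  let F := p2 (hd_code K) in
  let tag := p1 (hd_code K) in
  let K' := tl_code K in
  if K =? 0 then cfg_ret a 0
  else if tag =? 0 then cfg_run F a K'
  else if tag =? 1 then
    cfg_run (p1 F) (cons_code (p1 (p2 F)) (cons_code a (p2 (p2 F)))) K'
  else if tag =? 2 then
    if a =? 0 then cfg_ret (p1 (p2 F)) K'
    else cfg_run (p1 F) (cons_code (S (p1 (p2 F))) (p2 (p2 F)))
           (cons_code (pr 2 (pr (p1 F) (pr (S (p1 (p2 F))) (p2 (p2 F))))) K')
  else if tag =? 3 then cfg_runs (p1 F) (p2 F) (cons_code (pr 4 a) K')
  else cfg_ret (cons_code F a) K'.

Definition step (s : nat) : nat :=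
  let a := p1 (p2 s) in
  let b := p1 (p2 (p2 s)) in
  let K := p2 (p2 (p2 s)) in
  if p1 s =? 0 then step_run a b K
  else if p1 s =? 1 then step_runs a b K
  else step_ret a K.

Definition reaches (s s' : nat) : Prop := exists n, Nat.iter n step s = s'.

Lemma reaches_refl s : reaches s s.
Proof. now exists 0. Qed.

Lemma reaches_step s s' s'' : step s = s' -> reaches s' s'' -> reaches s s''.
Proof. intros <- [n <-]. exists (S n). apply Nat.iter_succ_r. Qed.

Lemma reaches_trans s s' s'' : reaches s s' -> reaches s' s'' -> reaches s s''.
Proof.
  intros [n <-] [m <-]. exists (m + n). apply Nat.iter_add.
Qed.

Ltac machine_step := unfold step, step_run, step_runs, step_ret, cfg_run, cfg_runs,
  cfg_ret, config; repeat (rewrite ?p1_pr, ?p2_pr, ?hd_cons, ?tl_cons; cbn [Nat.eqb pred]).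

Ltac machine := eapply reaches_step; [machine_step; reflexivity|].

(** Recursion on the derivations themselves, because in [ev_mu] the derivations of the nonzero
    values lie under an existential. The stack is arbitrary, as subprograms run on top of frames. *)
Fixpoint eval_reaches c v y (H : eval c v y) {struct H} : forall K,
  reaches (cfg_run (code_nat c) (list_code v) K) (cfg_ret y K)
with evalL_reaches gs v ys (H : evalL gs v ys) {struct H} : forall K,
  reaches (cfg_runs (list_code (map code_nat gs)) (list_code v) K)
    (cfg_ret (list_code ys) K).
Proof.
  - destruct H as [v|x v|i v Hi|f gs v ys y Hs Hf|f g v y Hf|f g n v z y Hr Hg|f v n Hf Hm];
      intros K; cbn [code_nat list_code fold_right map].
    + machine. apply reaches_refl.
    + machine. apply reaches_refl.
    + machine. rewrite nth_code_spec by easy. apply reaches_refl.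
    + machine. eapply reaches_trans; [apply (evalL_reaches _ _ _ Hs)|].
      machine. apply (eval_reaches _ _ _ Hf).
    + machine. apply (eval_reaches _ _ _ Hf).
    + machine. eapply reaches_trans; [apply (eval_reaches _ _ _ Hr)|].
      machine. apply (eval_reaches _ _ _ Hg).
    + machine.
      (* The loop gets to every [m <= n], since all earlier values exist and are nonzero. *)
      assert (Hloop : forall m, m <= n -> reaches
        (cfg_run (code_nat f) (cons_code 0 (list_code v))
          (cons_code (pr 2 (pr (code_nat f) (pr 0 (list_code v)))) K))
        (cfg_run (code_nat f) (cons_code m (list_code v))
          (cons_code (pr 2 (pr (code_nat f) (pr m (list_code v)))) K))).
      { induction m as [|m IH]; intros Hle; [apply reaches_refl|].
        eapply reaches_trans; [apply IH; lia|].
        destruct (Hm m Hle) as [k Hk].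
        eapply reaches_trans; [apply (eval_reaches _ _ _ Hk)|].
        machine. apply reaches_refl. }
      eapply reaches_trans; [apply (Hloop n (le_n n))|].
      eapply reaches_trans; [apply (eval_reaches _ _ _ Hf)|].
      machine. apply reaches_refl.
  - destruct H as [v|g gs v y ys Hg Hs]; intros K; cbn [list_code fold_right map].
    + machine. apply reaches_refl.
    + eapply reaches_step; [machine_step; reflexivity|].
      eapply reaches_trans; [apply (eval_reaches _ _ _ Hg)|].
      machine. eapply reaches_trans; [apply (evalL_reaches _ _ _ Hs)|].
      machine. apply reaches_refl.
Qed.

Definition run (e n t : nat) : nat := Nat.iter t step (cfg_run e (cons_code n 0) 0).

(** Evaluation bounded by [t] steps: [S y] stands for the value [y], and 0 for no value yet. *)
Definition Phi (e n t : nat) : nat :=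
  if (p1 (run e n t) =? 2) && (p2 (p2 (p2 (run e n t))) =? 0)
  then S (p1 (p2 (run e n t))) else 0.

(** A halted configuration is a fixed point of [step]. *)
Lemma Phi_mono e n t t' y : Phi e n t = S y -> t <= t' -> Phi e n t' = S y.
Proof.
  intros H. induction 1 as [|t' _ IH]; [easy|].
  revert IH. unfold Phi. change (run e n (S t')) with (step (run e n t')).
  destruct (Nat.eqb_spec (p1 (run e n t')) 2) as [H1|]; [|easy].
  destruct (Nat.eqb_spec (p2 (p2 (p2 (run e n t')))) 0) as [H2|]; [|easy].
  cbn [andb]. unfold step. rewrite H1, H2. now machine_step.
Qed.

Lemma Phi_universal f : computable_fun f ->
  exists e, forall n, exists t, Phi e n t = S (f n).
Proof.
  intros [c Hc]. exists (code_nat c). intros n.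
  destruct (eval_reaches c [n] (f n) (Hc n) 0) as [t Ht]. exists t.
  unfold Phi, run. rewrite (Ht : Nat.iter _ _ (cfg_run _ (cons_code n 0) 0) = _).
  now machine_step.
Qed.

Lemma computable_cfg_run f g h : computable_fun f -> computable_fun g ->
  computable_fun h -> computable_fun (fun x => cfg_run (f x) (g x) (h x)).
Proof. unfold cfg_run, config. comp. Qed.

Lemma computable_cfg_runs f g h : computable_fun f -> computable_fun g ->
  computable_fun h -> computable_fun (fun x => cfg_runs (f x) (g x) (h x)).
Proof. unfold cfg_runs, config. comp. Qed.

Lemma computable_cfg_ret f h : computable_fun f -> computable_fun h ->
  computable_fun (fun x => cfg_ret (f x) (h x)).
Proof. unfold cfg_ret, config. comp. Qed.
#[export] Hint Resolve computable_cfg_run computable_cfg_runs computable_cfg_ret : comp.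

Lemma computable_step : computable_fun step.
Proof.
  unfold step, step_run, step_runs, step_ret. cbv zeta.
  comp.
Qed.

Lemma computable_Phi f g h : computable_fun f -> computable_fun g -> computable_fun h ->
  computable_fun (fun x => Phi (f x) (g x) (h x)).
Proof.
  intros Hf Hg Hh.
  assert (Hr : computable_fun (fun x => run (f x) (g x) (h x))).
  { apply computable_iter; [apply computable_step|comp|comp]. }
  unfold Phi. comp.
Qed.
#[export] Hint Resolve computable_Phi : comp.

(** * The construction *)

(* [Node e k d l c N A B] works for the [e]-th program: [k] is the argument used for
   diagonalisation and the exponent of the intended jump, [d] tells whether the jump
   was made, [l] is the last expansionary stage, and the gate holds [N] chunks of size
   [2^-c] not yet passed on. [A] guesses that there are infinitely many expansionary
   stages, [B] that there are no more of them. *)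
Inductive tree : Type :=
| Leaf (e : nat)
| Node (e k : nat) (d : bool) (l c N : nat) (A B : tree).

(** By [k <= t] the jump is a multiple of [2^-t], so gates can cut it into whole chunks. The last
    conjunct bounds the value found by [t]: the jump is not made before the stage that the program
    names. *)
Definition acts (e k : nat) (d : bool) (t : nat) : bool :=
  negb d && (k <=? t) && (0 <? Phi e k t) && (Phi e k t <=? S t).

(** [Phi] returns a value [y] as [S y], so the bounds read [l < y <= t]. *)
Definition expands (e l t : nat) : bool :=
  existsb (fun m => (S l <? Phi e m t) && (Phi e m t <=? S t)) (seq 0 (S t)).

(* [Some i] in the result is an amount [2^-i] handed on to the parent. *)
Fixpoint tick (t : nat) (U : tree) : tree * option nat :=
  match U with
  | Leaf e => (Node e (t + e + 2) false t 0 0 (Leaf (S e)) (Leaf (S e)), None)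
  | Node e k d l c N A B =>
      if acts e k d t then
        (Node e k true t 0 0 (Leaf (S e)) (Leaf (S e)), Some k)
      else if expands e l t then
        match N with
        | 0 =>
            (Node e k d t t (match snd (tick t A) with None => 0 | Some i => 2 ^ (t - i) end)
              (fst (tick t A)) (Leaf (S e)), None)
        | S N' => (Node e k d t c N' A (Leaf (S e)), Some c)
        end
      else (Node e k d l c N A (fst (tick t B)), snd (tick t B))
  end.

(** * Computability of the construction *)

Fixpoint tree_nat (U : tree) : nat :=
  match U with
  | Leaf e => pr 0 e
  | Node e k d l c N A B =>
      pr 1 (pr (pr e k) (pr (pr (Nat.b2n d) l) (pr (pr c N) (pr (tree_nat A) (tree_nat B)))))
  end.

(** Codes decrease towards the leaves, so [tick] becomes a course-of-values recursion on codes. *)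
Lemma tree_nat_child e k d l c N A B :
  tree_nat A < tree_nat (Node e k d l c N A B) /\
  tree_nat B < tree_nat (Node e k d l c N A B).
Proof.
  cbn [tree_nat]. set (x := tree_nat A). set (y := tree_nat B).
  pose proof (pr_ge x y). set (z := pr x y) in *. pose proof (pr_ge (pr c N) z).
  set (z1 := pr (pr c N) z) in *. pose proof (pr_ge (pr (Nat.b2n d) l) z1).
  set (z2 := pr (pr (Nat.b2n d) l) z1) in *. pose proof (pr_ge (pr e k) z2).
  pose proof (pr_ge 1 (pr (pr e k) z2)). lia.
Qed.

Definition option_nat (o : option nat) : nat :=
  match o with None => 0 | Some i => S i end.

(** [tick] on codes, with the results for the two subtrees looked up in the history [h]. *)
Definition tick_body (t z h : nat) : nat :=
  let e := p1 (p1 (p2 z)) in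
  let k := p2 (p1 (p2 z)) in
  let d := p1 (p1 (p2 (p2 z))) in
  let l := p2 (p1 (p2 (p2 z))) in
  let c := p1 (p1 (p2 (p2 (p2 z)))) in
  let N := p2 (p1 (p2 (p2 (p2 z)))) in
  let A := p1 (p2 (p2 (p2 (p2 z)))) in
  let B := p2 (p2 (p2 (p2 (p2 z)))) in
  let rA := cov_lookup z A h in
  let rB := cov_lookup z B h in
  let node e k d l c N A B := pr 1 (pr (pr e k) (pr (pr d l) (pr (pr c N) (pr A B)))) in
  if p1 z =? 0 then
    pr (node (p2 z) (t + p2 z + 2) 0 t 0 0 (pr 0 (S (p2 z))) (pr 0 (S (p2 z)))) 0
  else if (d =? 0) && (k <=? t) && (0 <? Phi e k t) && (Phi e k t <=? S t) then
    pr (node e k 1 t 0 0 (pr 0 (S e)) (pr 0 (S e))) (S k)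
  else if expands e l t then
    if N =? 0 then
      pr (node e k d t t (if p2 rA =? 0 then 0 else 2 ^ (t - pred (p2 rA)))
        (p1 rA) (pr 0 (S e))) 0
    else pr (node e k d t c (pred N) A (pr 0 (S e))) (S c)
  else pr (node e k d l c N A (p1 rB)) (p2 rB).

Lemma tick_body_spec t U : cov_rec tick_body t (tree_nat U) =
  pr (tree_nat (fst (tick t U))) (option_nat (snd (tick t U))).
Proof.
  induction U as [e|e k d l c N A IHA B IHB].
  - unfold cov_rec, tick_body. cbn. now rewrite p1_pr, p2_pr.
  - assert (HA : tree_nat A < tree_nat (Node e k d l c N A B)) by apply tree_nat_child.
    assert (HB : tree_nat B < tree_nat (Node e k d l c N A B)) by apply tree_nat_child.
    rewrite <- (cov_lookup_spec tick_body t _ _ HA) in IHA.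
    rewrite <- (cov_lookup_spec tick_body t _ _ HB) in IHB.
    unfold cov_rec, tick_body.
    set (h := cov_history _ _ _) in *. clearbody h. clear HA HB.
    set (z := tree_nat (Node e k d l c N A B)) in *.
    assert (Hz : z = pr 1 (pr (pr e k) (pr (pr (Nat.b2n d) l)
      (pr (pr c N) (pr (tree_nat A) (tree_nat B)))))) by reflexivity.
    clearbody z.
    replace (p1 z) with 1 by now rewrite Hz, p1_pr.
    replace (p1 (p1 (p2 z))) with e by now rewrite Hz, !p2_pr, !p1_pr.
    replace (p2 (p1 (p2 z))) with k by now rewrite Hz, !p2_pr, !p1_pr, !p2_pr.
    replace (p1 (p1 (p2 (p2 z)))) with (Nat.b2n d) by now rewrite Hz, !p2_pr, !p1_pr.
    replace (p2 (p1 (p2 (p2 z)))) with l by now rewrite Hz, !p2_pr, !p1_pr, !p2_pr.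
    replace (p1 (p1 (p2 (p2 (p2 z))))) with c by now rewrite Hz, !p2_pr, !p1_pr.
    replace (p2 (p1 (p2 (p2 (p2 z))))) with N by now rewrite Hz, !p2_pr, !p1_pr, !p2_pr.
    replace (p1 (p2 (p2 (p2 (p2 z))))) with (tree_nat A) by now rewrite Hz, !p2_pr, !p1_pr.
    replace (p2 (p2 (p2 (p2 (p2 z))))) with (tree_nat B) by now rewrite Hz, !p2_pr.
    rewrite IHA, IHB, !p1_pr, !p2_pr. cbn [Nat.eqb tick].
    replace (Nat.b2n d =? 0) with (negb d) by now destruct d.
    fold (acts e k d t).
    destruct (acts e k d t); [easy|]. destruct (expands e l t); [|easy].
    destruct N as [|N]; [|easy]. cbn [Nat.eqb fst snd tree_nat].
    now destruct (snd (tick t A)).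
Qed.

Lemma computable_expands e l t : computable_fun e -> computable_fun l ->
  computable_fun t -> computable_fun (fun x => Nat.b2n (expands (e x) (l x) (t x))).
Proof.
  intros He Hl Ht. unfold expands.
  apply (computable_existsb (fun x m => (S (l x) <? Phi (e x) m (t x)) &&
    (Phi (e x) m (t x) <=? S (t x)))); [|comp].
  pose proof (fun f Hf => computable_comp f p1 Hf computable_p1) as Hc.
  apply Hc in He, Hl, Ht. comp.
Qed.
#[export] Hint Resolve computable_expands : comp.

Lemma computable_cov_lookup f g h : computable_fun f -> computable_fun g ->
  computable_fun h -> computable_fun (fun x => cov_lookup (f x) (g x) (h x)).
Proof. unfold cov_lookup. comp. Qed.
#[export] Hint Resolve computable_cov_lookup : comp.

Lemma computable_tick_body : computable3 tick_body.
Proof.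
  unfold computable3, tick_body. cbv zeta beta.
  comp.
Qed.

(** The number is the numerator, over the denominator [2^t], of all that the root has emitted;
    doubling passes to the next denominator. *)
Fixpoint state (t : nat) : tree * nat :=
  match t with
  | 0 => (Leaf 0, 0)
  | S t => (fst (tick t (fst (state t))),
      2 * snd (state t) +
      match snd (tick t (fst (state t))) with None => 0 | Some i => 2 ^ (S t - i) end)
  end.

Definition root (t : nat) : tree := fst (state t).
Definition numer (t : nat) : nat := snd (state t).

Lemma computable_state :
  computable_fun (fun t => tree_nat (root t)) /\ computable_fun numer.
Proof.
  set (st := fun t => nat_rect (fun _ => nat) (pr (pr 0 0) 0) (fun t s =>
    pr (p1 (cov_rec tick_body t (p1 s)))
     (2 * p2 s + (if p2 (cov_rec tick_body t (p1 s)) =? 0 then 0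
       else 2 ^ (S t - pred (p2 (cov_rec tick_body t (p1 s))))))) t).
  assert (Hst : computable_fun st).
  { apply computable_rec with (g := fun _ t s => pr (p1 (cov_rec tick_body t (p1 s)))
     (2 * p2 s + (if p2 (cov_rec tick_body t (p1 s)) =? 0 then 0
       else 2 ^ (S t - pred (p2 (cov_rec tick_body t (p1 s))))))); [comp| |comp].
    pose proof (fun f g => computable_cov_rec tick_body f g computable_tick_body) as H.
    comp. }
  assert (Heq : forall t, st t = pr (tree_nat (root t)) (numer t)).
  { induction t as [|t IH]; [easy|].
    unfold st. cbn [nat_rect]. fold (st t).
    rewrite IH, p1_pr, p2_pr, tick_body_spec, p1_pr, p2_pr.
    unfold root, numer. cbn [state fst snd].
    now destruct (snd (tick t (fst (state t)))). }
  split.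
  - apply computable_ext with (fun t => p1 (st t)); [|comp].
    intros t. now rewrite Heq, p1_pr.
  - apply computable_ext with (fun t => p2 (st t)); [|comp].
    intros t. now rewrite Heq, p2_pr.
Qed.

(** * Emitted amounts *)

Definition index (U : tree) : nat :=
  match U with Leaf e => e | Node e _ _ _ _ _ _ _ => e end.

Fixpoint wf (t : nat) (U : tree) : Prop :=
  match U with
  | Leaf _ => True
  | Node e _ _ _ c _ A B => c <= t /\ index A = S e /\ index B = S e /\ wf t A /\ wf t B
  end.

Lemma wf_mono t t' U : t <= t' -> wf t U -> wf t' U.
Proof. intros Ht. induction U; cbn; [easy|]. intuition lia. Qed.

Lemma index_tick t U : index (fst (tick t U)) = index U.
Proof.
  destruct U as [|e k d l c N A B]; [easy|]. cbn [tick].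
  destruct (acts e k d t), (expands e l t), N; easy.
Qed.

Lemma wf_tick t U : wf t U -> wf (S t) (fst (tick t U)).
Proof.
  induction U as [e|e k d l c N A IHA B IHB]; cbn [tick].
  - intros _. cbn. auto with arith.
  - cbn [wf]. intros (Hc & HA & HB & WA & WB).
    pose proof (wf_mono t (S t) A ltac:(lia) WA). pose proof (wf_mono t (S t) B ltac:(lia) WB).
    destruct (acts e k d t); [cbn; auto with arith|].
    destruct (expands e l t); [destruct N|]; cbn; rewrite ?index_tick; auto 10 with arith.
Qed.

(** A jump satisfies [k <= t] by [acts], and a chunk exponent is at most [t] by [wf]. Hence every
    amount is a multiple of [2^-t] and is cut without remainder. *)
Lemma tick_emission_le t U i : wf t U -> snd (tick t U) = Some i -> i <= t.
Proof.
  induction U as [e|e k d l c N A IHA B IHB]; cbn [tick wf]; [easy|].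
  intros (Hc & _ & _ & _ & WB).
  destruct (acts e k d t) eqn:Ha.
  - intros [= <-]. unfold acts in Ha. rewrite !Bool.andb_true_iff in Ha.
    now apply Nat.leb_le.
  - destruct (expands e l t); [destruct N|]; cbn [snd]; try easy.
    + now intros [= <-].
    + auto.
Qed.

Open Scope R_scope.

Definition half (n : nat) : R := / 2 ^ n.

Lemma half_pos n : 0 < half n.
Proof. apply Rinv_0_lt_compat, pow_lt. lra. Qed.

Lemma half_S n : half (S n) = half n / 2.
Proof. unfold half. cbn [pow]. field. apply pow_nonzero. lra. Qed.

Lemma half_add m n : half (m + n) = half m * half n.
Proof. unfold half. now rewrite pow_add, Rinv_mult. Qed.

Lemma half_le m n : (m <= n)%nat -> half n <= half m.
Proof.
  induction 1 as [|n _ IH]; [lra|]. rewrite half_S. pose proof (half_pos n). lra.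
Qed.

Lemma half_split i t : (i <= t)%nat -> INR (2 ^ (t - i)) * half t = half i.
Proof.
  intros Hi. replace t with ((t - i) + i)%nat at 2 by lia.
  rewrite half_add, pow_INR, <- Rmult_assoc. change (INR 2) with 2. unfold half at 1.
  rewrite Rinv_r; [lra|]. apply pow_nonzero. lra.
Qed.

Definition amount (o : option nat) : R :=
  match o with None => 0 | Some i => half i end.

Lemma amount_nonneg o : 0 <= amount o.
Proof. destruct o; [apply Rlt_le, half_pos|apply Rle_refl]. Qed.

Fixpoint mass (U : tree) : R :=
  match U with
  | Leaf _ => 0
  | Node _ k d _ c N A B =>
      (if d then 0 else half k) + INR N * half c + mass A + mass B
  end.

Lemma mass_nonneg U : 0 <= mass U.
Proof.
  induction U as [|e k d l c N A IHA B IHB]; cbn [mass]; [lra|].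
  pose proof (half_pos k). pose proof (half_pos c). pose proof (pos_INR N).
  assert (0 <= INR N * half c) by (apply Rmult_le_pos; lra).
  destruct d; lra.
Qed.

(* [mass] bounds everything the existing nodes can still emit; a tick creates at most
   one node, whose jump has size at most [half (t + index U + 2)]. *)
Lemma tick_mass t U : wf t U ->
  amount (snd (tick t U)) + mass (fst (tick t U)) <= mass U + half (t + index U + 2).
Proof.
  induction U as [e|e k d l c N A IHA B IHB]; intros Hwf.
  - cbn. lra.
  - destruct Hwf as (Hc & HA & HB & WA & WB).
    specialize (IHA WA). specialize (IHB WB). rewrite HA in IHA. rewrite HB in IHB.
    replace (t + S e + 2)%nat with (S (t + e + 2)) in IHA, IHB by lia.
    rewrite half_S in IHA, IHB.
    pose proof (half_pos (t + e + 2)). pose proof (mass_nonneg A). pose proof (mass_nonneg B).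
    pose proof (half_pos c). pose proof (half_pos k). pose proof (pos_INR N).
    assert (0 <= INR N * half c) by (apply Rmult_le_pos; lra).
    cbn [tick index]. destruct (acts e k d t) eqn:Ha.
    + destruct d; [easy|]. cbn. lra.
    + destruct (expands e l t); [destruct N as [|N]|]; cbn [mass fst snd amount].
      (* What [A] emits is kept in the gate: [2^(t-i)] chunks of size [2^-t] make up [2^-i]. *)
      * destruct (snd (tick t A)) as [i|] eqn:Hi; cbn [amount] in IHA.
        -- rewrite half_split by now apply (tick_emission_le t A). cbn. destruct d; lra.
        -- cbn. destruct d; lra.
      * rewrite S_INR. destruct d; lra.
      * destruct d; lra.
Qed.

Definition approx (t : nat) : R := INR (numer t) * half t.

Lemma wf_root t : wf t (root t).
Proof. induction t; [easy|]. now apply wf_tick. Qed.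

Lemma approx_S t : approx (S t) = approx t + amount (snd (tick t (root t))).
Proof.
  unfold approx, numer. cbn [state snd]. fold (root t).
  destruct (snd (tick t (root t))) as [i|] eqn:Hi; cbn [amount].
  - apply tick_emission_le in Hi; [|apply wf_root].
    rewrite plus_INR, mult_INR, Rmult_plus_distr_r, half_split by lia.
    rewrite half_S. cbn. field.
  - rewrite Nat.add_0_r, mult_INR, half_S. cbn. field.
Qed.

Lemma approx_mono t t' : (t <= t')%nat -> approx t <= approx t'.
Proof.
  induction 1 as [|t' _ IH]; [lra|].
  rewrite approx_S. pose proof (amount_nonneg (snd (tick t' (root t')))). lra.
Qed.

Fixpoint cumul (g : nat -> R) (t : nat) : R :=
  match t with O => 0 | S t => cumul g t + g t end.

(** Telescoping with a potential function [F]; the bounds on emissions below come from suitable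
    choices of [F]. *)
Lemma cumul_le g F a b : (a <= b)%nat ->
  (forall i, (a <= i < b)%nat -> g i <= F (S i) - F i) ->
  cumul g b - cumul g a <= F b - F a.
Proof.
  induction 1 as [|b Hab IH]; intros H; [lra|]. cbn [cumul].
  pose proof (H b ltac:(lia)). specialize (IH ltac:(intros; apply H; lia)). lra.
Qed.

Lemma cumul_ge g F a b : (a <= b)%nat ->
  (forall i, (a <= i < b)%nat -> F (S i) - F i <= g i) ->
  F b - F a <= cumul g b - cumul g a.
Proof.
  induction 1 as [|b Hab IH]; intros H; [lra|]. cbn [cumul].
  pose proof (H b ltac:(lia)). specialize (IH ltac:(intros; apply H; lia)). lra.
Qed.

(** * Runs of a subtree *)

Definition emit (U : nat -> tree) (V : nat -> bool) (t : nat) : R :=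
  if V t then amount (snd (tick t (U t))) else 0.

Lemma emit_nonneg U V t : 0 <= emit U V t.
Proof. unfold emit. destruct (V t); [apply amount_nonneg|lra]. Qed.

Lemma cumul_emit_mono U V a b : (a <= b)%nat -> cumul (emit U V) a <= cumul (emit U V) b.
Proof.
  intros H. pose proof (cumul_ge (emit U V) (fun _ => 0) a b H) as H0. cbn in H0.
  enough (0 - 0 <= cumul (emit U V) b - cumul (emit U V) a) by lra. apply H0.
  intros. pose proof (emit_nonneg U V i). lra.
Qed.

(* [U] is the subtree of level [e] on the true path, from its last creation at stage
   [T0] on, and [V] is the set of stages at which it is visited. All gates above it
   are empty at these stages, so the growth of [approx] between two of them is what [U]
   has emitted plus the contribution of nodes to the right, which restart at [u]. *)
Record is_run (e : nat) (U : nat -> tree) (V : nat -> bool) (T0 : nat) : Prop := {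
  run_U : exists f, computable_fun f /\ forall t, (T0 <= t)%nat -> f t = tree_nat (U t);
  run_V : exists f, computable_fun f /\ forall t, (T0 <= t)%nat -> f t = Nat.b2n (V t);
  run_V0 : V T0 = true;
  run_U0 : U T0 = Leaf e;
  run_le : (e <= T0)%nat;
  run_step : forall t, (T0 <= t)%nat -> U (S t) = if V t then fst (tick t (U t)) else U t;
  run_inf : forall t, exists t', (t <= t')%nat /\ V t' = true;
  run_upper : forall u u', (T0 <= u <= u')%nat -> V u = true ->
    approx u' - approx u <=
      cumul (emit U V) u' - cumul (emit U V) u + half u * (1 / 2 - half (S e));
  run_lower : forall u u', (T0 <= u <= u')%nat -> V u = true -> V u' = true ->
    cumul (emit U V) u' - cumul (emit U V) u <= approx u' - approx u
}.

Lemma root_run : is_run 0 root (fun _ => true) 0.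
Proof.
  assert (Hx : forall t, approx t = cumul (emit root (fun _ => true)) t).
  { induction t as [|t IH]; [unfold approx; cbn; lra|]. rewrite approx_S, IH. reflexivity. }
  constructor; auto.
  - exists (fun t => tree_nat (root t)). split; [apply computable_state|easy].
  - exists (fun _ => 1%nat). split; [apply computable_const|easy].
  - intros t. now exists t.
  (* At level 0 the allowance for nodes to the right is [half u * (1 / 2 - half 1) = 0]. *)
  - intros u u' _ _. rewrite !Hx. unfold half at 2. cbn. lra.
  - intros u u' _ _ _. rewrite !Hx. lra.
Qed.

Lemma run_wf e U V T0 t : is_run e U V T0 -> (T0 <= t)%nat -> wf t (U t) /\ index (U t) = e.
Proof.
  intros HR. induction 1 as [|t Ht [IH1 IH2]].
  - now rewrite (run_U0 _ _ _ _ HR).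
  - rewrite (run_step _ _ _ _ HR) by easy. destruct (V t).
    + rewrite index_tick. split; [now apply wf_tick|easy].
    + split; [apply (wf_mono t); auto|easy].
Qed.

(** The potential combines the mass with [2^-(t+e+1)], the sum of [2^-(i+e+2)] over [i >= t], which
    pays for the nodes still to be created. The mass is 0 at the creation stage [T0]. *)
Lemma run_total e U V T0 t : is_run e U V T0 -> (T0 <= t)%nat ->
  cumul (emit U V) t - cumul (emit U V) T0 <= half T0 * half (S e).
Proof.
  intros HR Ht.
  pose proof (cumul_le (emit U V) (fun i => - mass (U i) - half (i + e + 1)) T0 t Ht) as H.
  cbn beta in H. rewrite (run_U0 _ _ _ _ HR) in H. cbn [mass] in H.
  replace (T0 + e + 1)%nat with (T0 + S e)%nat in H by lia. rewrite (half_add T0) in H.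
  pose proof (mass_nonneg (U t)). pose proof (half_pos (t + e + 1)).
  enough (forall i, (T0 <= i < t)%nat ->
    emit U V i <= - mass (U (S i)) - half (S i + e + 1) - (- mass (U i) - half (i + e + 1)))
    by (specialize (H ltac:(assumption)); lra).
  intros i Hi. destruct (run_wf _ _ _ _ i HR ltac:(lia)) as [W I].
  pose proof (tick_mass i (U i) W) as M. rewrite I in M.
  rewrite (run_step _ _ _ _ HR) by lia.
  replace (i + e + 2)%nat with (S (i + e + 1)) in M by lia.
  replace (S i + e + 1)%nat with (S (i + e + 1)) by lia.
  rewrite half_S in *. pose proof (half_pos (i + e + 1)).
  unfold emit. destruct (V i); lra.
Qed.

(** The emissions of the subtree and the allowance for nodes to the right add up to [half T0] times
    [half (S e) + (1 / 2 - half (S e))]. *)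
Lemma run_regains e U V T0 t : is_run e U V T0 -> (T0 <= t)%nat ->
  approx t - approx T0 <= half T0 / 2.
Proof.
  intros HR Ht. pose proof (run_total _ _ _ _ t HR Ht).
  pose proof (run_upper _ _ _ _ HR T0 t ltac:(lia) (run_V0 _ _ _ _ HR)). lra.
Qed.

Lemma least_true (p : nat -> bool) a : (exists t, (a <= t)%nat /\ p t = true) ->
  exists t, (a <= t)%nat /\ p t = true /\ forall j, (a <= j < t)%nat -> p j = false.
Proof.
  intros H.
  destruct (dec_inh_nat_subset_has_unique_least_element
    (fun t => (a <= t)%nat /\ p t = true)) as [t [[[H1 H2] H3] _]]; [|easy|].
  - intros t. destruct (p t), (Nat.le_gt_cases a t); intuition (easy || lia).
  - exists t. repeat split; auto. intros j Hj. destruct (p j) eqn:E; [|easy].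
    specialize (H3 j ltac:(split; [lia|easy])). lia.
Qed.

(** * Nodes after their last action *)

Definition is_node (e k : nat) (d : bool) (U : tree) : Prop :=
  exists l c N A B, U = Node e k d l c N A B.

Lemma node_persists e U V T0 k d a b : is_run e U V T0 -> (T0 <= a <= b)%nat ->
  is_node e k d (U a) ->
  (forall j, (a <= j < b)%nat -> V j = true -> acts e k d j = false) ->
  is_node e k d (U b).
Proof.
  intros HR [Ha Hb] Hn. induction Hb as [|b Hb IH]; intros Hj; [easy|].
  destruct (IH ltac:(intros; apply Hj; auto; lia)) as (l & c & N & A & B & E).
  rewrite (run_step _ _ _ _ HR) by lia. rewrite E.
  destruct (V b) eqn:Vb; [|now repeat eexists].
  cbn [tick]. rewrite Hj by (auto; lia).
  destruct (expands e l b); [destruct N|]; now repeat eexists.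
Qed.

(** [T1] comes right after the creation of the node or right after its action, if there is one; from
    then on [k] and [d] are final. The last field keeps the action as a witness against a
    modulus. *)
Record settled (e k : nat) (d : bool) (U : nat -> tree) (V : nat -> bool) (T0 T1 : nat)
  : Prop := {
  settled_run : is_run e U V T0;
  settled_lt : (T0 < T1)%nat;
  settled_start : exists l, U T1 = Node e k d l 0 0 (Leaf (S e)) (Leaf (S e));
  settled_node : forall t, (T1 <= t)%nat -> is_node e k d (U t);
  settled_quiet : forall t, (T1 <= t)%nat -> V t = true -> acts e k d t = false;
  settled_acted : d = true -> exists t y, (T0 <= t)%nat /\ V t = true /\
    Phi e k t = S y /\ (y <= t)%nat /\ emit U V t = half k
}.

(** Acting sets [d], so a node acts at most once. Whether it ever does is decided classically. *)
Lemma run_settles e U V T0 : is_run e U V T0 -> exists k d T1, settled e k d U V T0 T1.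
Proof.
  intros HR. set (k := (T0 + e + 2)%nat).
  assert (H0 : U (S T0) = Node e k false T0 0 0 (Leaf (S e)) (Leaf (S e))).
  { rewrite (run_step _ _ _ _ HR), (run_V0 _ _ _ _ HR), (run_U0 _ _ _ _ HR) by lia.
    reflexivity. }
  destruct (classic (exists t, (S T0 <= t)%nat /\ V t && acts e k false t = true))
    as [Hex|Hno].
  - apply least_true in Hex as (t & Ht & Hact & Hmin).
    apply Bool.andb_true_iff in Hact as [Vt Hact].
    destruct (node_persists e U V T0 k false (S T0) t HR) as (l & c & N & A & B & E);
      [lia|rewrite H0; now repeat eexists| |].
    { intros j Hj Vj. specialize (Hmin j Hj). now rewrite Vj in Hmin. }
    assert (H1 : U (S t) = Node e k true t 0 0 (Leaf (S e)) (Leaf (S e))).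
    { rewrite (run_step _ _ _ _ HR), Vt, E by lia. cbn [tick]. now rewrite Hact. }
    exists k, true, (S t). constructor; auto; try lia.
    + now exists t.
    + intros j Hj. apply (node_persists e U V T0 k true (S t) j HR); [lia| |easy].
      rewrite H1. now repeat eexists.
    + intros _. exists t, (pred (Phi e k t)).
      assert (Hem : emit U V t = half k).
      { unfold emit. rewrite Vt, E. cbn [tick]. now rewrite Hact. }
      unfold acts in Hact. rewrite !Bool.andb_true_iff, Nat.ltb_lt, !Nat.leb_le in Hact.
      repeat split; auto; lia.
  - exists k, false, (S T0).
    assert (Hq : forall t, (S T0 <= t)%nat -> V t = true -> acts e k false t = false).
    { intros t Ht Vt. destruct (acts e k false t) eqn:Ha; [|easy].
      destruct Hno. exists t. now rewrite Vt. }
    constructor; auto; try easy; try lia.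
    + now exists T0.
    + intros j Hj. apply (node_persists e U V T0 k false (S T0) j HR); [lia| |].
      * rewrite H0. now repeat eexists.
      * intros i Hi. apply Hq. lia.
Qed.

Lemma Phi_functional e n t t' y y' : Phi e n t = S y -> Phi e n t' = S y' -> y = y'.
Proof.
  intros H H'. apply (Phi_mono _ _ _ (max t t')) in H, H'; lia.
Qed.

Lemma run_no_modulus e U V T0 g : is_run e U V T0 ->
  (forall n, exists t, Phi e n t = S (g n)) ->
  exists k u, approx (g k) + half k <= approx u.
Proof.
  intros HR Hg. destruct (run_settles _ _ _ _ HR) as (k & d & T1 & HS).
  exists k. destruct (Hg k) as [t0 Ht0]. destruct d.
  - destruct (settled_acted _ _ _ _ _ _ _ HS eq_refl) as (t & y & Ht & Vt & Hy & Hle & Hem).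
    (* The jump may be held up in gates above, but these are empty at the next visit [u], so
       [approx u] contains it. *)
    destruct (run_inf _ _ _ _ HR (S t)) as (u & Hu & Vu). exists u.
    rewrite <- (Phi_functional _ _ _ _ _ _ Hy Ht0).
    pose proof (approx_mono y t Hle).
    pose proof (run_lower _ _ _ _ HR t u ltac:(lia) Vt Vu).
    pose proof (cumul_emit_mono U V (S t) u Hu) as Hm. cbn [cumul] in Hm. lra.
  (* Impossible: the program converges at [k], so the node would act at a late enough visit. *)
  - destruct (run_inf _ _ _ _ HR (t0 + T1 + k + g k)) as (t & Ht & Vt).
    exfalso. pose proof (settled_quiet _ _ _ _ _ _ _ HS t ltac:(lia) Vt) as Hq.
    apply Bool.not_true_iff_false in Hq. apply Hq. unfold acts.
    rewrite (Phi_mono e k t0 t (g k) Ht0 ltac:(lia)).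
    rewrite !Bool.andb_true_iff, Nat.ltb_lt, !Nat.leb_le. cbn. lia.
Qed.

(** * The true path *)

Definition last_exp (U : tree) : nat :=
  match U with Leaf _ => 0%nat | Node _ _ _ l _ _ _ _ => l end.
Definition chunk (U : tree) : nat :=
  match U with Leaf _ => 0%nat | Node _ _ _ _ c _ _ _ => c end.
Definition pending (U : tree) : nat :=
  match U with Leaf _ => 0%nat | Node _ _ _ _ _ N _ _ => N end.
Definition left_child (U : tree) : tree :=
  match U with Leaf _ => U | Node _ _ _ _ _ _ A _ => A end.
Definition right_child (U : tree) : tree :=
  match U with Leaf _ => U | Node _ _ _ _ _ _ _ B => B end.

Definition expanding (U : nat -> tree) (V : nat -> bool) (t : nat) : bool :=
  V t && expands (index (U t)) (last_exp (U t)) t.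
Definition visit_left (U : nat -> tree) (V : nat -> bool) (t : nat) : bool :=
  expanding U V t && (pending (U t) =? 0)%nat.
Definition visit_right (U : nat -> tree) (V : nat -> bool) (t : nat) : bool :=
  V t && negb (expands (index (U t)) (last_exp (U t)) t).
Definition gate (U : tree) : R := INR (pending U) * half (chunk U).

Definition emit_gate (U : nat -> tree) (V : nat -> bool) (t : nat) : R :=
  if expanding U V t && negb (pending (U t) =? 0)%nat then half (chunk (U t)) else 0.

(** One stage of a settled node by cases: visited or not, expansionary or not, gate empty or not. *)
Ltac settled_step HS V t Ht :=
  let l := fresh "l" in let c := fresh "c" in let N := fresh "N" in
  let A := fresh "A" in let B := fresh "B" in let E := fresh "E" in
  let Hq := fresh "Hq" in let Hst := fresh "Hst" in
  destruct (settled_node _ _ _ _ _ _ _ HS t Ht) as (l & c & N & A & B & E);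
  pose proof (settled_quiet _ _ _ _ _ _ _ HS t Ht) as Hq;
  assert (Hst := run_step _ _ _ _ (settled_run _ _ _ _ _ _ _ HS) t
    ltac:(pose proof (settled_lt _ _ _ _ _ _ _ HS); lia));
  rewrite E in Hst; cbn [tick] in Hst;
  unfold emit_gate, visit_left, visit_right, expanding, gate, emit in *; cbv beta in *;
  rewrite ?E in *; cbn [index last_exp chunk pending left_child right_child tick] in *;
  destruct (V t) eqn:?; cbn [andb] in *;
  [rewrite Hq in * by reflexivity;
   destruct (expands _ l t) eqn:?; cbn [negb andb] in *; [destruct N as [|N]|]|];
  rewrite ?Hst; cbn [index last_exp chunk pending left_child right_child tick Nat.eqb
    andb negb fst snd mass amount] in *.

Lemma emit_split e k d U V T0 T1 t : settled e k d U V T0 T1 -> (T1 <= t)%nat ->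
  emit U V t = emit_gate U V t + emit (fun i => right_child (U i)) (visit_right U V) t.
Proof. intros HS Ht. settled_step HS V t Ht; try easy; lra. Qed.

Lemma wf_children e k d U V T0 T1 t : settled e k d U V T0 T1 -> (T1 <= t)%nat ->
  (wf t (left_child (U t)) /\ index (left_child (U t)) = S e) /\
  (wf t (right_child (U t)) /\ index (right_child (U t)) = S e).
Proof.
  intros HS Ht. pose proof (settled_lt _ _ _ _ _ _ _ HS).
  destruct (run_wf _ _ _ _ t (settled_run _ _ _ _ _ _ _ HS) ltac:(lia)) as [W _].
  destruct (settled_node _ _ _ _ _ _ _ HS t Ht) as (l & c & N & A & B & E).
  rewrite E in *. cbn in *. tauto.
Qed.

(** Conservation at the gate: emissions of the left child go in, chunks come out. *)
Lemma gate_step e k d U V T0 T1 t : settled e k d U V T0 T1 -> (T1 <= t)%nat ->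
  emit_gate U V t + gate (U (S t)) =
  gate (U t) + emit (fun i => left_child (U i)) (visit_left U V) t.
Proof.
  intros HS Ht. destruct (wf_children _ _ _ _ _ _ _ t HS Ht) as [[W _] _].
  settled_step HS V t Ht; try lra.
  - destruct (snd (tick t A)) as [i|] eqn:Hi; cbn [amount].
    + rewrite half_split by now apply (tick_emission_le t A). cbn. lra.
    + cbn. lra.
  - rewrite S_INR. lra.
Qed.

Lemma left_step e k d U V T0 T1 t : settled e k d U V T0 T1 -> (T1 <= t)%nat ->
  left_child (U (S t)) =
  if visit_left U V t then fst (tick t (left_child (U t))) else left_child (U t).
Proof. intros HS Ht. settled_step HS V t Ht; easy. Qed.

Lemma right_step e k d U V T0 T1 t : settled e k d U V T0 T1 -> (T1 <= t)%nat ->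
  right_child (U (S t)) = if expanding U V t then Leaf (S e)
    else if visit_right U V t then fst (tick t (right_child (U t))) else right_child (U t).
Proof. intros HS Ht. settled_step HS V t Ht; easy. Qed.

Lemma last_exp_step e k d U V T0 T1 t : settled e k d U V T0 T1 -> (T1 <= t)%nat ->
  last_exp (U (S t)) = if expanding U V t then t else last_exp (U t).
Proof. intros HS Ht. settled_step HS V t Ht; easy. Qed.

Lemma pending_step e k d U V T0 T1 t : settled e k d U V T0 T1 -> (T1 <= t)%nat ->
  visit_left U V t = false ->
  pending (U (S t)) = if expanding U V t then pred (pending (U t)) else pending (U t).
Proof. intros HS Ht. settled_step HS V t Ht; easy. Qed.

Lemma chunk_step e k d U V T0 T1 t : settled e k d U V T0 T1 -> (T1 <= t)%nat ->
  chunk (U (S t)) = if visit_left U V t then t else chunk (U t).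
Proof. intros HS Ht. settled_step HS V t Ht; easy. Qed.

Lemma settled_index e k d U V T0 T1 t : settled e k d U V T0 T1 -> (T1 <= t)%nat ->
  index (U t) = e.
Proof.
  intros HS Ht. now destruct (settled_node _ _ _ _ _ _ _ HS t Ht)
    as (l & c & N & A & B & ->).
Qed.

(** The potential of [run_total], one level down. Replacing the right child by a leaf at
    expansionary stages only lowers its mass. *)
Lemma emit_right_le e k d U V T0 T1 a b : settled e k d U V T0 T1 -> (T1 <= a <= b)%nat ->
  let E := cumul (emit (fun i => right_child (U i)) (visit_right U V)) in
  E b - E a <= mass (right_child (U a)) + half (a + e + 2).
Proof.
  intros HS [Ha Hab] E.
  pose proof (cumul_le (emit (fun i => right_child (U i)) (visit_right U V))
    (fun i => - mass (right_child (U i)) - half (i + e + 2)) a b Hab) as H.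
  cbn beta in H. fold E in H.
  pose proof (mass_nonneg (right_child (U b))). pose proof (half_pos (b + e + 2)).
  lapply H; [lra|]. clear H. intros i Hi.
  destruct (wf_children _ _ _ _ _ _ _ i HS ltac:(lia)) as [_ [W I]].
  pose proof (tick_mass i _ W) as M. rewrite I in M.
  rewrite (right_step _ _ _ _ _ _ _ i HS) by lia.
  replace (i + S e + 2)%nat with (S (i + e + 2)) in M by lia.
  replace (S i + e + 2)%nat with (S (i + e + 2)) by lia.
  rewrite half_S in *. pose proof (half_pos (i + e + 2)).
  pose proof (mass_nonneg (right_child (U i))).
  unfold emit, visit_right, expanding in *.
  destruct (V i), (expands (index (U i)) (last_exp (U i)) i); cbn [andb negb mass]; lra.
Qed.

Lemma run_balance e k d U V T0 T1 a b : settled e k d U V T0 T1 -> (T1 <= a <= b)%nat ->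
  let E := cumul (emit U V) in
  let EA := cumul (emit (fun i => left_child (U i)) (visit_left U V)) in
  let EB := cumul (emit (fun i => right_child (U i)) (visit_right U V)) in
  E b - E a + gate (U b) = gate (U a) + (EA b - EA a) + (EB b - EB a).
Proof.
  intros HS [Ha Hab]. cbv zeta. induction Hab as [|b Hab IH]; [lra|]. cbn [cumul].
  pose proof (gate_step _ _ _ _ _ _ _ b HS ltac:(lia)).
  pose proof (emit_split _ _ _ _ _ _ _ b HS ltac:(lia)). lra.
Qed.

Lemma visit_left_gate U V t : visit_left U V t = true -> gate (U t) = 0.
Proof.
  unfold visit_left, gate. rewrite Bool.andb_true_iff, Nat.eqb_eq.
  intros [_ ->]. cbn. lra.
Qed.

(** Each expansionary stage lets one pending chunk pass, and only visits of the left child add new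
    ones; so the gate runs empty. *)
Lemma visit_left_infinite e k d U V T0 T1 : settled e k d U V T0 T1 ->
  (forall t, exists t', (t <= t')%nat /\ expanding U V t' = true) ->
  forall t, exists t', (t <= t')%nat /\ visit_left U V t' = true.
Proof.
  intros HS Hinf.
  assert (H : forall N t, (T1 <= t)%nat -> pending (U t) = N ->
    exists t', (t <= t')%nat /\ visit_left U V t' = true).
  { induction N as [|N IH]; intros t Ht HN;
      destruct (least_true _ _ (Hinf t)) as (t' & Ht' & He & Hmin).
    all: assert (Hp : forall j, (t <= j <= t')%nat -> pending (U j) = pending (U t)).
    1,3: intros j [Hj Hjt]; induction Hj as [|j Hj IHj]; [easy|];
      rewrite (pending_step _ _ _ _ _ _ _ j HS), Hmin by
        (lia || (unfold visit_left; rewrite Hmin by lia; easy)); apply IHj; lia.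
    - exists t'. split; [easy|]. unfold visit_left. now rewrite He, Hp, HN by lia.
    - assert (Hv : visit_left U V t' = false).
      { unfold visit_left. rewrite Hp, HN by lia. apply Bool.andb_false_r. }
      destruct (IH (S t')) as (u & Hu & Hvu); [lia| |exists u; split; [lia|easy]].
      rewrite (pending_step _ _ _ _ _ _ _ t' HS), He, Hp, HN by (lia || easy). easy. }
  intros t. destruct (H _ (T1 + t)%nat ltac:(lia) eq_refl) as (t' & Ht' & Hv).
  exists t'. split; [lia|easy].
Qed.

(** The data of a node can be read off its code, so computability is inherited along the true path.
    The modulus in [run_nearly_computable] relies on this. *)
Lemma computable_children e k d U V T0 T1 : settled e k d U V T0 T1 ->
  (exists f, computable_fun f /\ forall t, (T1 <= t)%nat -> f t = tree_nat (left_child (U t))) /\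
  (exists f, computable_fun f /\ forall t, (T1 <= t)%nat -> f t = tree_nat (right_child (U t))) /\
  (exists f, computable_fun f /\ forall t, (T1 <= t)%nat -> f t = Nat.b2n (visit_left U V t)) /\
  (exists f, computable_fun f /\ forall t, (T1 <= t)%nat -> f t = Nat.b2n (visit_right U V t)).
Proof.
  intros HS. pose proof (settled_lt _ _ _ _ _ _ _ HS) as Hlt.
  destruct (run_U _ _ _ _ (settled_run _ _ _ _ _ _ _ HS)) as (f & Hf & Ef).
  destruct (run_V _ _ _ _ (settled_run _ _ _ _ _ _ _ HS)) as (g & Hg & Eg).
  set (lN := fun t => p2 (p1 (p2 (p2 (f t))))).
  set (NN := fun t => p2 (p1 (p2 (p2 (p2 (f t)))))).
  assert (HlN : computable_fun lN) by (unfold lN; comp).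
  assert (HNN : computable_fun NN) by (unfold NN; comp).
  assert (Hcode : forall t, (T1 <= t)%nat ->
    p1 (p2 (p2 (p2 (p2 (f t))))) = tree_nat (left_child (U t)) /\
    p2 (p2 (p2 (p2 (p2 (f t))))) = tree_nat (right_child (U t)) /\
    lN t = last_exp (U t) /\ NN t = pending (U t)).
  { intros t Ht. unfold lN, NN. rewrite Ef by lia.
    destruct (settled_node _ _ _ _ _ _ _ HS t Ht) as (l & c & N & A & B & ->).
    cbn [tree_nat left_child right_child last_exp pending].
    now rewrite !p2_pr, !p1_pr, !p2_pr. }
  assert (Hb : forall b : bool, (Nat.b2n b =? 1)%nat = b) by now intros [].
  repeat split.
  - exists (fun t => p1 (p2 (p2 (p2 (p2 (f t)))))). split; [comp|apply Hcode].
  - exists (fun t => p2 (p2 (p2 (p2 (p2 (f t)))))). split; [comp|apply Hcode].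
  - exists (fun t => Nat.b2n ((g t =? 1)%nat && expands e (lN t) t && (NN t =? 0)%nat)).
    split; [comp|]. intros t Ht. destruct (Hcode t Ht) as (_ & _ & -> & ->).
    rewrite Eg, Hb by lia. unfold visit_left, expanding.
    now rewrite (settled_index _ _ _ _ _ _ _ t HS Ht).
  - exists (fun t => Nat.b2n ((g t =? 1)%nat && negb (expands e (lN t) t))).
    split; [comp|]. intros t Ht. destruct (Hcode t Ht) as (_ & _ & -> & _).
    rewrite Eg, Hb by lia. unfold visit_right.
    now rewrite (settled_index _ _ _ _ _ _ _ t HS Ht).
Qed.

Lemma first_visit (W : nat -> tree) (p : nat -> bool) a L : W a = L ->
  (forall t, (a <= t)%nat -> W (S t) = if p t then fst (tick t (W t)) else W t) ->
  (forall t, exists t', (t <= t')%nat /\ p t' = true) ->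
  exists T, (a <= T)%nat /\ p T = true /\ W T = L.
Proof.
  intros Ha Hstep Hinf. destruct (least_true p a (Hinf a)) as (T & HT & Hp & Hmin).
  exists T. repeat split; auto.
  assert (H : forall j, (a <= j <= T)%nat -> W j = L).
  { intros j [Hj HjT]. induction Hj as [|j Hj IH]; [easy|].
    rewrite Hstep, Hmin by lia. apply IH. lia. }
  apply H. lia.
Qed.

(** The gate is empty at visits of the left child, so between two of them the node emits exactly
    what its children emit. The right child restarts at [u] and adds at most [2^-(u+e+2)], which
    turns the factor [1/2 - 2^-(e+1)] into [1/2 - 2^-(e+2)]. *)
Lemma left_run e k d U V T0 T1 : settled e k d U V T0 T1 ->
  (forall t, exists t', (t <= t')%nat /\ expanding U V t' = true) ->
  exists T, is_run (S e) (fun t => left_child (U t)) (visit_left U V) T.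
Proof.
  intros HS Hexp. pose proof (settled_lt _ _ _ _ _ _ _ HS) as Hlt.
  pose proof (settled_run _ _ _ _ _ _ _ HS) as HR.
  pose proof (visit_left_infinite _ _ _ _ _ _ _ HS Hexp) as Hinf.
  destruct (first_visit (fun t => left_child (U t)) (visit_left U V) T1 (Leaf (S e)))
    as (T & HT & HV & HL); auto.
  { now destruct (settled_start _ _ _ _ _ _ _ HS) as [l ->]. }
  { intros t Ht. now apply (left_step _ _ _ _ _ _ _ t HS). }
  destruct (computable_children _ _ _ _ _ _ _ HS) as ((f & Hf & Ef) & _ & (g & Hg & Eg) & _).
  pose proof (run_le _ _ _ _ HR).
  assert (HVV : forall t, visit_left U V t = true -> V t = true).
  { intros t. unfold visit_left, expanding. now destruct (V t). }
  exists T. constructor; auto.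
  - exists f. split; [easy|]. intros. apply Ef. lia.
  - exists g. split; [easy|]. intros. apply Eg. lia.
  - lia.
  - intros t Ht. apply (left_step _ _ _ _ _ _ _ t HS). lia.
  - intros u u' [Hu Huu] Hv.
    pose proof (run_upper _ _ _ _ HR u u' ltac:(lia) (HVV u Hv)) as H1.
    pose proof (run_balance _ _ _ _ _ _ _ u u' HS ltac:(lia)) as H2. cbv zeta in H2.
    rewrite (visit_left_gate _ _ _ Hv) in H2.
    assert (0 <= gate (U u')).
    { apply Rmult_le_pos; [apply pos_INR|apply Rlt_le, half_pos]. }
    set (EB := cumul (emit (fun i => right_child (U i)) (visit_right U V))) in *.
    assert (H3 : EB u' - EB u <= half (u + e + 2)).
    { inversion Huu as [|u'' Huu' Eu]; [pose proof (half_pos (u' + e + 2)); lra|].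
      rewrite Eu.
      pose proof (emit_right_le _ _ _ _ _ _ _ (S u) u' HS ltac:(lia)) as H3.
      cbv zeta in H3. fold EB in H3.
      assert (He : expanding U V u = true).
      { unfold visit_left in Hv. now apply Bool.andb_true_iff in Hv. }
      rewrite (right_step _ _ _ _ _ _ _ u HS), He in H3 by lia. cbn [mass] in H3.
      assert (H4 : EB (S u) = EB u).
      { unfold EB. cbn [cumul]. unfold emit, visit_right. unfold expanding in He.
        destruct (V u), (expands (index (U u)) (last_exp (U u)) u); try easy.
        cbn [andb negb]. lra. }
      pose proof (half_le (u + e + 2) (S u + e + 2) ltac:(lia)). lra. }
    replace (u + e + 2)%nat with (u + S (S e))%nat in H3 by lia.
    rewrite half_add in H3. rewrite (half_S (S e)) in *. lra.
  - intros u u' [Hu Huu] Hv Hv'.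
    pose proof (run_lower _ _ _ _ HR u u' ltac:(lia) (HVV u Hv) (HVV u' Hv')) as H1.
    pose proof (run_balance _ _ _ _ _ _ _ u u' HS ltac:(lia)) as H2. cbv zeta in H2.
    rewrite (visit_left_gate _ _ _ Hv), (visit_left_gate _ _ _ Hv') in H2.
    pose proof (cumul_emit_mono (fun i => right_child (U i)) (visit_right U V) u u' Huu). lra.
Qed.

(** After the last expansionary stage every visit goes on to the right child and the gate stays
    shut, so node and child emit the same. *)
Lemma right_run e k d U V T0 T1 : settled e k d U V T0 T1 ->
  ~ (forall t, exists t', (t <= t')%nat /\ expanding U V t' = true) ->
  exists T, is_run (S e) (fun t => right_child (U t)) (visit_right U V) T.
Proof.
  intros HS Hexp. pose proof (settled_lt _ _ _ _ _ _ _ HS) as Hlt.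
  pose proof (settled_run _ _ _ _ _ _ _ HS) as HR.
  (* [T2] follows the last expansionary stage, or is [T1] if there is none from [T1] on; the right
     child is a leaf there in both cases. *)
  assert (H2 : exists T2, (T1 <= T2)%nat /\ right_child (U T2) = Leaf (S e) /\
    forall t, (T2 <= t)%nat -> expanding U V t = false).
  { apply not_all_ex_not in Hexp as [b Hb].
    assert (Hbb : forall t, (T1 + b <= t)%nat -> expanding U V t = false).
    { intros t Ht. destruct (expanding U V t) eqn:E; [|easy].
      destruct Hb. exists t. split; [lia|easy]. }
    clear Hb. induction b as [|b IH].
    - exists T1. repeat split; auto.
      + now destruct (settled_start _ _ _ _ _ _ _ HS) as [l ->].
      + intros t Ht. apply Hbb. lia.
    - destruct (expanding U V (T1 + b)) eqn:E.
      + exists (S (T1 + b)). repeat split; [lia| |intros; apply Hbb; lia].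
        now rewrite (right_step _ _ _ _ _ _ _ _ HS), E by lia.
      + apply IH. intros t Ht. destruct (Nat.eq_dec t (T1 + b)) as [->|]; [easy|].
        apply Hbb. lia. }
  destruct H2 as (T2 & HT2 & HL2 & Hno).
  assert (HVV : forall t, (T2 <= t)%nat -> visit_right U V t = V t).
  { intros t Ht. specialize (Hno t Ht). unfold expanding in Hno. unfold visit_right.
    now destruct (V t), (expands (index (U t)) (last_exp (U t)) t). }
  assert (Hstep : forall t, (T2 <= t)%nat -> right_child (U (S t)) =
    if visit_right U V t then fst (tick t (right_child (U t))) else right_child (U t)).
  { intros t Ht. now rewrite (right_step _ _ _ _ _ _ _ t HS), Hno by lia. }
  assert (Hinf : forall t, exists t', (t <= t')%nat /\ visit_right U V t' = true).
  { intros t. destruct (run_inf _ _ _ _ HR (T2 + t)) as (t' & Ht' & Hv).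
    exists t'. rewrite HVV by lia. split; [lia|easy]. }
  destruct (first_visit (fun t => right_child (U t)) (visit_right U V) T2 (Leaf (S e)))
    as (T & HT & HV & HL); auto.
  destruct (computable_children _ _ _ _ _ _ _ HS) as (_ & (f & Hf & Ef) & _ & (g & Hg & Eg)).
  pose proof (run_le _ _ _ _ HR).
  assert (Hem : forall a b, (T2 <= a <= b)%nat ->
    cumul (emit U V) b - cumul (emit U V) a =
    cumul (emit (fun i => right_child (U i)) (visit_right U V)) b -
    cumul (emit (fun i => right_child (U i)) (visit_right U V)) a).
  { intros a b [Ha Hab]. induction Hab as [|b Hab IH]; [lra|]. cbn [cumul].
    rewrite (emit_split _ _ _ _ _ _ _ b HS) by lia. unfold emit_gate.
    rewrite Hno by lia. cbn [andb]. lra. }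
  exists T. constructor; auto.
  - exists f. split; [easy|]. intros. apply Ef. lia.
  - exists g. split; [easy|]. intros. apply Eg. lia.
  - lia.
  - intros t Ht. apply Hstep. lia.
  - intros u u' Hu Hv. rewrite HVV in Hv by lia.
    pose proof (run_upper _ _ _ _ HR u u' ltac:(lia) Hv) as H1.
    rewrite Hem in H1 by lia.
    pose proof (half_pos u). pose proof (half_pos (S e)).
    rewrite (half_S (S e)).
    assert (0 <= half u * half (S e)) by (apply Rmult_le_pos; lra). lra.
  - intros u u' Hu Hv Hv'. rewrite HVV in Hv, Hv' by lia. rewrite <- Hem by lia.
    apply (run_lower _ _ _ _ HR); auto. lia.
Qed.

(** The true path turns left at a node with infinitely many expansionary stages and right at any
    other. *)
Lemma run_exists e : exists U V T0, is_run e U V T0.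
Proof.
  induction e as [|e (U & V & T0 & HR)].
  - exists root, (fun _ => true), 0%nat. apply root_run.
  - destruct (run_settles _ _ _ _ HR) as (k & d & T1 & HS).
    destruct (classic (forall t, exists t', (t <= t')%nat /\ expanding U V t' = true)).
    + destruct (left_run _ _ _ _ _ _ _ HS) as [T HT]; eauto.
    + destruct (right_run _ _ _ _ _ _ _ HS) as [T HT]; eauto.
Qed.

(** * The requirements *)

Lemma strictly_increasing_lt s : strictly_increasing s ->
  forall i j, (i < j)%nat -> (s i < s j)%nat.
Proof.
  intros Hs i j. induction 1 as [|j _ IH]; [apply Hs|]. specialize (Hs j). lia.
Qed.

Lemma strictly_increasing_ge s : strictly_increasing s -> forall n, (n <= s n)%nat.
Proof. intros Hs. induction n as [|n IH]; [lia|]. specialize (Hs n). lia. Qed.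

(** If [last_exp] stayed at [l], the value [s (S l) > l] would in the end make a visit
    expansionary. *)
Lemma expanding_infinite e k d U V T0 T1 s : settled e k d U V T0 T1 ->
  (forall n, exists t, Phi e n t = S (s n)) -> strictly_increasing s ->
  forall t, exists t', (t <= t')%nat /\ expanding U V t' = true.
Proof.
  intros HS Hs Hinc t. apply NNPP. intros Hno.
  assert (Hn : forall j, (t <= j)%nat -> expanding U V j = false).
  { intros j Hj. destruct (expanding U V j) eqn:E; [|easy]. destruct Hno. eauto. }
  assert (Hl : forall j, (T1 + t <= j)%nat -> last_exp (U j) = last_exp (U (T1 + t)%nat)).
  { induction 1 as [|j Hj IH]; [easy|].
    now rewrite (last_exp_step _ _ _ _ _ _ _ j HS), Hn by lia. }
  set (l := last_exp (U (T1 + t)%nat)) in *. destruct (Hs (S l)) as [t0 Ht0].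
  destruct (run_inf _ _ _ _ (settled_run _ _ _ _ _ _ _ HS)
    (T1 + t + t0 + S l + s (S l))%nat) as (j & Hj & Vj).
  specialize (Hn j ltac:(lia)). unfold expanding in Hn.
  rewrite Vj, Hl, (settled_index _ _ _ _ _ _ _ j HS) in Hn by lia.
  apply Bool.not_true_iff_false in Hn. apply Hn. cbn [andb]. unfold expands.
  apply existsb_exists. exists (S l). rewrite in_seq. split; [lia|].
  rewrite (Phi_mono e (S l) t0 j _ Ht0) by lia.
  pose proof (strictly_increasing_ge s Hinc (S l)).
  rewrite Bool.andb_true_iff, Nat.ltb_lt, Nat.leb_le. lia.
Qed.

Lemma last_visit (V : nat -> bool) a b : V a = true -> (a <= b)%nat ->
  exists u, (a <= u <= b)%nat /\ V u = true /\ forall j, (u < j <= b)%nat -> V j = false.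
Proof.
  intros Ha. induction 1 as [|b Hab (u & Hu & Hv & Hno)].
  - exists a. repeat split; auto. lia.
  - destruct (V (S b)) eqn:E.
    + exists (S b). repeat split; auto; lia.
    + exists u. repeat split; auto; try lia.
      intros j Hj. destruct (Nat.eq_dec j (S b)) as [->|]; [easy|]. apply Hno. lia.
Qed.

(** The chunk size is reset only at visits of the left child, to [2^-t] at stage [t]. So it is at
    most [2^-u] after [u], and at [u] itself the gate is empty. *)
Lemma emit_gate_le e k d U V T0 T1 u t : settled e k d U V T0 T1 -> (T1 <= u <= t)%nat ->
  visit_left U V u = true ->
  emit_gate U V t <= if expanding U V t then half u else 0.
Proof.
  intros HS [Hu Hut] Hv. pose proof (half_pos u). unfold emit_gate.
  destruct (expanding U V t) eqn:He; cbn [andb]; [|lra].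
  destruct (Nat.eqb_spec (pending (U t)) 0) as [|Hp]; cbn [negb]; [lra|].
  apply half_le. inversion Hut as [|t' Hut' Et].
  - subst t. unfold visit_left in Hv. rewrite Bool.andb_true_iff, Nat.eqb_eq in Hv. tauto.
  - clear He Hp. induction Hut' as [|t' Hut' IH] in t, Et, Hut |- *.
    + rewrite (chunk_step _ _ _ _ _ _ _ u HS), Hv; lia.
    + rewrite (chunk_step _ _ _ _ _ _ _ (S t') HS) by lia.
      destruct (visit_left U V (S t')); [lia|]. apply (IH (S t')); lia.
Qed.

(* Two expansionary stages are separated by a value of [s], so at most one of them
   lies between [s m] and [s (S m)]. *)
Lemma emit_gate_interval e k d U V T0 T1 s u m : settled e k d U V T0 T1 ->
  (forall n, exists t, Phi e n t = S (s n)) -> strictly_increasing s ->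
  (T1 <= u <= s m)%nat -> visit_left U V u = true ->
  cumul (emit_gate U V) (s (S m)) - cumul (emit_gate U V) (s m) <= half u.
Proof.
  intros HS Hs Hinc Hu Hv. pose proof (half_pos u).
  (* This potential rises only at the first expansionary stage from [s m] on. *)
  pose proof (cumul_le (emit_gate U V)
    (fun t => if (s m <=? last_exp (U t))%nat then half u else 0) (s m) (s (S m))
    ltac:(specialize (Hinc m); lia)) as H0.
  cbv beta in H0. lapply H0; clear H0.
  { destruct (s m <=? last_exp (U (s (S m))))%nat, (s m <=? last_exp (U (s m)))%nat; lra. }
  intros i Hi.
  pose proof (emit_gate_le _ _ _ _ _ _ _ u i HS ltac:(lia) Hv) as Hle.
  rewrite (last_exp_step _ _ _ _ _ _ _ i HS) by lia.
  destruct (expanding U V i) eqn:He; [|lra].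
  replace (s m <=? i)%nat with true by (symmetry; apply Nat.leb_le; lia).
  destruct (Nat.leb_spec (s m) (last_exp (U i))) as [Hl|]; [exfalso|lra].
  unfold expanding in He. apply Bool.andb_true_iff in He as [_ He].
  unfold expands in He. apply existsb_exists in He as (n & _ & He).
  rewrite Bool.andb_true_iff, Nat.ltb_lt, Nat.leb_le in He.
  rewrite (settled_index _ _ _ _ _ _ _ i HS) in He by lia.
  destruct (Hs n) as [t Ht].
  destruct (Phi e n i) as [|y] eqn:Ey; [lia|].
  rewrite (Phi_functional _ _ _ _ _ _ Ey Ht) in He.
  destruct (Nat.lt_trichotomy n m) as [Hn|[->|Hn]].
  - pose proof (strictly_increasing_lt s Hinc n m Hn). lia.
  - lia.
  - destruct (Nat.eq_dec n (S m)) as [->|]; [lia|].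
    pose proof (strictly_increasing_lt s Hinc (S m) n ltac:(lia)). lia.
Qed.

(** The modulus searches for a late visit [t1] of the left child. From then on each chunk, and the
    right child as a whole, contributes at most [2^-t1]. Two chunks, the right child and the
    allowance [2^-t1 / 2] for nodes further right make [7/2] times [2^-t1], which is below [2^-n] as
    [t1 >= n + 3]. *)
Lemma run_nearly_computable e U V T0 s : is_run e U V T0 ->
  (forall n, exists t, Phi e n t = S (s n)) -> strictly_increasing s ->
  exists f, computable_fun f /\
    forall n m, (f n <= m)%nat -> approx (s (S m)) - approx (s m) < half n.
Proof.
  intros HR Hs Hinc. destruct (run_settles _ _ _ _ HR) as (k & d & T1 & HS).
  pose proof (settled_lt _ _ _ _ _ _ _ HS) as Hlt.
  pose proof (visit_left_infinite _ _ _ _ _ _ _ HS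
    (expanding_infinite _ _ _ _ _ _ _ s HS Hs Hinc)) as Hinf.
  destruct (computable_children _ _ _ _ _ _ _ HS) as (_ & _ & (g & Hg & Eg) & _).
  destruct (computable_search (fun n t =>
    if (n + 3 + T1 <=? t)%nat && (g t =? 1)%nat then 0%nat else 1%nat)) as (f & Hf & Ef).
  { assert (computable_fun (fun p => g (p2 p))) by (apply computable_comp; comp). comp. }
  { intros n. destruct (Hinf (n + 3 + T1)%nat) as (t & Ht & Hv). exists t.
    rewrite Eg, Hv by lia. now apply Nat.leb_le in Ht as ->. }
  exists f. split; [easy|]. intros n m Hm.
  assert (Hfn : (n + 3 + T1 <= f n)%nat /\ visit_left U V (f n) = true).
  { specialize (Ef n). destruct (Nat.leb_spec (n + 3 + T1) (f n)) as [Hle|]; [|easy].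
    split; [easy|]. rewrite Eg in Ef by lia. now destruct (visit_left U V (f n)). }
  destruct Hfn as [Hfn Hv]. set (t1 := f n) in *. clearbody t1.
  pose proof (strictly_increasing_ge s Hinc m) as Hsm. pose proof (Hinc m) as Hsm1.
  assert (He1 : expanding U V t1 = true).
  { unfold visit_left in Hv. now apply Bool.andb_true_iff in Hv. }
  assert (HV1 : V t1 = true).
  { unfold expanding in He1. now apply Bool.andb_true_iff in He1. }
  (* [run_upper] has to start at a visit, which [s m] may fail to be. *)
  destruct (last_visit V t1 (s m) HV1 ltac:(lia)) as (u & Hu & HVu & Hno).
  pose proof (run_upper _ _ _ _ HR u (s (S m)) ltac:(lia) HVu) as H1.
  set (CG := cumul (emit_gate U V)).
  set (EB := cumul (emit (fun i => right_child (U i)) (visit_right U V))).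
  assert (H2 : cumul (emit U V) (s (S m)) - cumul (emit U V) u =
    (CG (s (S m)) - CG u) + (EB (s (S m)) - EB u)).
  { assert (Hus : (u <= s (S m))%nat) by lia. revert Hus. generalize (s (S m)) as b.
    induction 1 as [|b Hb IH]; [lra|]. unfold CG, EB in *. cbn [cumul].
    rewrite (emit_split _ _ _ _ _ _ _ b HS) by lia. lra. }
  pose proof (half_pos t1) as Hp1.
  (* From [u] up to [s m] only [u] is a visit, so at most one chunk passes. *)
  assert (H3 : CG (s m) - CG u <= half t1).
  { pose proof (cumul_le (emit_gate U V) (fun t => if (u <? t)%nat then half t1 else 0)
      u (s m) ltac:(lia)) as H3. cbv beta in H3. fold CG in H3. rewrite Nat.ltb_irrefl in H3.
    lapply H3; clear H3; [destruct (u <? s m)%nat; lra|].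
    intros i Hi. pose proof (emit_gate_le _ _ _ _ _ _ _ t1 i HS ltac:(lia) Hv) as Hle.
    replace (u <? S i)%nat with true by (symmetry; apply Nat.ltb_lt; lia).
    destruct (Nat.ltb_spec u i) as [Hui|Hui].
    - unfold expanding in Hle. rewrite Hno in Hle by lia. cbn [andb] in Hle. lra.
    - destruct (expanding U V i); lra. }
  pose proof (emit_gate_interval _ _ _ _ _ _ _ s t1 m HS Hs Hinc ltac:(lia) Hv) as H4.
  fold CG in H4.
  assert (H5 : EB (s (S m)) - EB u <= half t1).
  { assert (H5 : EB t1 <= EB u) by (apply cumul_emit_mono; lia).
    assert (H6 : EB (S t1) = EB t1).
    { unfold EB. cbn [cumul]. unfold emit, visit_right. unfold expanding in He1.
      destruct (V t1), (expands (index (U t1)) (last_exp (U t1)) t1); try easy.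
      cbn [andb negb]. lra. }
    pose proof (emit_right_le _ _ _ _ _ _ _ (S t1) (s (S m)) HS ltac:(lia)) as H7.
    cbv zeta in H7. fold EB in H7.
    rewrite (right_step _ _ _ _ _ _ _ t1 HS), He1 in H7 by lia. cbn [mass] in H7.
    pose proof (half_le t1 (S t1 + e + 2) ltac:(lia)). lra. }
  pose proof (half_le t1 u ltac:(lia)) as H6.
  pose proof (half_le (n + 3) t1 ltac:(lia)) as H7.
  replace (n + 3)%nat with (S (S (S n))) in H7 by lia. rewrite !half_S in H7.
  pose proof (half_pos (S e)) as H8. pose proof (half_pos n). pose proof (half_pos u) as H9.
  assert (0 <= half u * half (S e)) by (apply Rmult_le_pos; lra).
  pose proof (approx_mono u (s m) ltac:(lia)).
  fold CG EB in H2. lra.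
Qed.

(** * The limit of the rational sequence *)

Definition approxQ (t : nat) : Q :=
  Qmake (Z.of_nat (numer t) - Z.of_nat 0) (Pos.of_succ_nat (pred (2 ^ t))).

Lemma computable_approxQ : computable_Qseq approxQ.
Proof.
  exists numer, (fun _ => 0%nat), (fun t => pred (2 ^ t)).
  repeat split; [apply computable_state|comp|comp].
Qed.

Lemma IZR_of_succ_nat n : IZR (Zpos (Pos.of_succ_nat n)) = INR (S n).
Proof. now rewrite INR_IZR_INZ. Qed.

Lemma Q2R_approxQ t : Q2R (approxQ t) = approx t.
Proof.
  unfold Q2R, approxQ, approx, half. cbn [Qnum Qden].
  rewrite IZR_of_succ_nat, Nat.succ_pred by (apply Nat.pow_nonzero; lia).
  rewrite pow_INR, Z.sub_0_r, <- INR_IZR_INZ. reflexivity.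
Qed.

Lemma no_computable_modulus g : computable_fun g ->
  exists k u, approx (g k) + half k <= approx u.
Proof.
  intros Hg. destruct (Phi_universal g Hg) as [e He].
  destruct (run_exists e) as (U & V & T0 & HR). now apply (run_no_modulus e U V T0).
Qed.

(** Approximations [r] of the limit would yield a modulus: once [approx t] exceeds
    [r (S k) - 2^-(S k)], it is within [2^-k] of the limit, against [no_computable_modulus]. *)
Lemma not_computable_limit X : Un_cv approx X -> (forall t, approx t <= X) -> ~ computable_real X.
Proof.
  intros Hcv HX (r & (a & b & d & Ha & Hb & Hd & Er) & Hr).
  (* [approx t > r (S k) - 2^-(S k)], multiplied by all denominators. *)
  set (test := fun k t =>
    (S (a (S k) * (2 ^ t * 2 ^ S k)) -
      (numer t * (S (d (S k)) * 2 ^ S k) + b (S k) * (2 ^ t * 2 ^ S k) +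
       S (d (S k)) * 2 ^ t))%nat).
  assert (Htest : forall k t, test k t = 0%nat <-> Q2R (r (S k)) - half (S k) < approx t).
  { intros k t. unfold test. rewrite Nat.sub_0_le, Er. unfold Q2R. cbn [Qnum Qden].
    rewrite IZR_of_succ_nat, minus_IZR, <- !INR_IZR_INZ. unfold approx, half.
    assert (0 < 2 ^ t)%R by (apply pow_lt; lra).
    assert (0 < 2 ^ S k)%R by (apply pow_lt; lra).
    assert (0 < INR (S (d (S k))))%R by (apply lt_0_INR; lia).
    set (P := (2 ^ t)%R) in *. set (K := (2 ^ S k)%R) in *. set (D := INR (S (d (S k)))) in *.
    assert (Hmul : forall y z : R, y < z <-> y * (P * K * D) < z * (P * K * D)).
    { intros y z.
      assert (0 < P * K * D) by (apply Rmult_lt_0_compat; [apply Rmult_lt_0_compat|]; easy).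
      split; intros; [now apply Rmult_lt_compat_r|eapply Rmult_lt_reg_r; eauto]. }
    rewrite Hmul.
    replace (((INR (a (S k)) - INR (b (S k))) * / D - / K) * (P * K * D)) with
      (INR (a (S k)) * (P * K) - (INR (b (S k)) * (P * K) + D * P)) by (field; lra).
    replace (INR (numer t) * / P * (P * K * D)) with (INR (numer t) * (D * K))
      by (field; lra).
    assert (HP : INR (2 ^ t) = P) by (now rewrite pow_INR).
    assert (HK : INR (2 ^ S k) = K) by (now rewrite pow_INR).
    unfold D in *. rewrite <- HP, <- HK, <- !mult_INR, <- !plus_INR.
    split; intros Hlt.
    - apply lt_INR in Hlt. rewrite !plus_INR in *. lra.
    - apply INR_lt. rewrite !plus_INR in *. lra. }
  destruct (computable_search test) as (g & Hg & Eg).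
  - unfold test.
    assert (HS : computable_fun (fun p => S (p1 p))) by comp.
    pose proof (computable_comp _ _ Ha HS). pose proof (computable_comp _ _ Hb HS).
    pose proof (computable_comp _ _ Hd HS).
    pose proof (computable_comp _ _ (proj2 computable_state) computable_p2). comp.
  (* The search ends because [r (S k) - 2^-(S k)] is below the limit. *)
  - intros k. specialize (Hr (S k)). fold (half (S k)) in Hr. apply Rabs_def2 in Hr.
    destruct (Hcv (X - (Q2R (r (S k)) - half (S k)))) as [N HN]; [lra|].
    exists N. apply Htest. specialize (HN N (le_n N)). unfold Rdist in HN.
    apply Rabs_def2 in HN. lra.
  - destruct (no_computable_modulus g Hg) as (k & u & Hu).
    pose proof (proj1 (Htest k (g k)) (Eg k)) as H1.
    specialize (Hr (S k)). fold (half (S k)) in Hr. apply Rabs_def2 in Hr.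
    rewrite half_S in *. specialize (HX u). lra.
Qed.

Theorem mainTheorem2 :
  exists x : R, regainingly_approximable x /\ nearly_computable x /\ ~ computable_real x.
Proof.
  assert (Hgrow : Un_growing approx) by (intros t; apply approx_mono; lia).
  assert (Hbound : has_ub approx).
  { exists (approx 0%nat + half 0 / 2). intros y [t ->].
    pose proof (run_regains _ _ _ _ t root_run ltac:(lia)). lra. }
  destruct (growing_cv approx Hgrow Hbound) as [X HX].
  pose proof (growing_ineq approx X Hgrow HX) as Hle.
  assert (Hcv : Un_cv (fun n => Q2R (approxQ n)) X).
  { intros eps Heps. destruct (HX eps Heps) as [N HN]. exists N. intros n Hn.
    rewrite Q2R_approxQ. now apply HN. }
  exists X. repeat split.
  - exists approxQ. repeat split; [apply computable_approxQ| |easy|].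
    + intros n. rewrite !Q2R_approxQ. apply approx_mono. lia.
    (* The limit is regained at the last creation stage [T >= N] of the node of level [N] on the
       true path: at most [2^-T / 2] is still to come. *)
    + intros N. destruct (run_exists N) as (U & V & T & HR). exists T.
      split; [apply (run_le _ _ _ _ HR)|]. rewrite Q2R_approxQ. fold (half T).
      pose proof (half_pos T).
      enough (X <= approx T + half T / 2) by lra.
      apply Rnot_lt_le. intros Hlt.
      destruct (HX (X - (approx T + half T / 2)) ltac:(lra)) as [M HM].
      specialize (HM (M + T)%nat ltac:(lia)). unfold Rdist in HM. apply Rabs_def2 in HM.
      pose proof (run_regains _ _ _ _ (M + T) HR ltac:(lia)). lra.
  - exists approxQ. split; [apply computable_approxQ|]. split; [easy|]. intros s Hs Hinc.
    (* The node on the true path that watches [s] provides the modulus. *)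
    destruct (Phi_universal s Hs) as [e He].
    destruct (run_exists e) as (U & V & T0 & HR).
    destruct (run_nearly_computable _ _ _ _ s HR He Hinc) as (f & Hf & Ef).
    exists f. split; [easy|]. intros n m Hm. rewrite !Q2R_approxQ. fold (half n).
    specialize (Ef n m Hm).
    pose proof (approx_mono (s m) (s (S m)) ltac:(specialize (Hinc m); lia)).
    rewrite Rminus_0_l, Rabs_Ropp, Rabs_right; lra.
  - now apply not_computable_limit.
Qed.
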